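(* Let $\zeta$-free notation be as in the context. For $0\le a\le 10$ put $$D_C(a,11):=\sum_{n\ge 0}\Big(M(a,11,n)-\tfrac{p(n)}{11}\Big)q^n .$$ Then, with $v_{11}$ as defined in the context, \begin{align*} D_{C}(0,11) &= v_{11}(10,-12,-2,8,6,4,-4,-6,-8,2),\\ D_{C}(1,11) &= v_{11}(-1,10,-2,-3,-5,4,7,5,3,2),\\ D_{C}(2,11) &= v_{11}(-1,-1,9,-3,6,-7,-4,-6,3,2),\\ D_{C}(3,11) &= v_{11}(-1,-1,-2,8,-5,4,-4,5,3,-9),\\ D_{C}(4,11) &= v_{11}(-1,-1,-2,-3,6,-7,7,5,-8,2),\\ D_{C}(5,11) &= v_{11}(-1,-1,-2,-3,-5,4,-4,-6,3,2). \end{align*}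
   Context: All series are formal power (or Laurent) series in $q$. $(x;q)_\infty=\prod_{i\ge0}(1-xq^i)$. For integers $a$ and $m>0$: $J_{a,m}:=(q^a;q^m)_\infty(q^{m-a};q^m)_\infty(q^m;q^m)_\infty$, $J_m:=(q^m;q^m)_\infty$, $P_i:=J_{i,11}$, $X_i:=J_{11i,121}$. $p(n)$ is the number of partitions of $n$ ($p(0)=1$). The crank of a partition $\pi$: let $\lambda(\pi)$ be its largest part, $\omega(\pi)$ its number of parts equal to $1$, and $\mu(\pi)$ its number of parts larger than $\omega(\pi)$; the crank is $\lambda(\pi)$ if $\omega(\pi)=0$ and $\mu(\pi)-\omega(\pi)$ otherwise. For $n\ge2$, $M(m,n)$ is the number of partitions of $n$ with crank $m$; for $n\le 1$ one sets $M(0,0)=1$, $M(0,1)=-1$, $M(1,1)=M(-1,1)=1$ and $M(m,n)=0$ otherwise (so $\sum_{n\ge0}\sum_m M(m,n)z^mq^n=\frac{(q;q)_\infty}{(zq;q)_\infty(z^{-1}q;q)_\infty}$). $M(a,r,n):=\sum_{m\equiv a \ (\mathrm{mod}\ r)}M(m,n)$. Define \begin{align*} v_{11}(a_0,a_1,a_2,a_3,a_4,a_5,a_7,a_8,a_9,a_{10}):=\frac{J_{121}^2}{11}\Big(& a_0\frac{1}{X_1}+a_1q\frac{X_5}{X_2X_3}+a_2q^2\frac{X_3}{X_1X_4}+a_3q^3\frac{X_2}{X_1X_3}+a_4q^4\frac{1}{X_2}\\ &+a_5q^5\frac{X_4}{X_2X_5}+a_7q^7\frac{1}{X_3}+a_8q^{19}\frac{X_1}{X_4X_5}+a_9q^9\frac{1}{X_4}+a_{10}q^{10}\frac{1}{X_5}\Big).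 \end{align*} *)

(* Defs.v *)
From mathcomp Require Import all_boot all_order all_algebra.
Set Implicit Arguments. Unset Strict Implicit. Unset Printing Implicit Defensive.
Import Order.TTheory GRing.Theory Num.Theory.
Local Open Scope ring_scope.

Definition fps := nat -> rat.

Definition fps_add (f g : fps) : fps := fun n => f n + g n.
Definition fps_scale (c : rat) (f : fps) : fps := fun n => c * f n.
Definition fps_mul (f g : fps) : fps :=
  fun n => \sum_(i < n.+1) f i * g (n - i)%N.
Definition fps_shift (k : nat) (f : fps) : fps :=
  fun n => if (k <= n)%N then f (n - k)%N else 0.

Fixpoint fps_inv_seq (f : fps) (n : nat) : seq rat :=
  match n with
  | 0 => [:: (f 0%N)^-1]
  | n'.+1 => let s := fps_inv_seq f n' in
      rcons s (- (f 0%N)^-1 *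
               \sum_(1 <= i < n'.+2) f i * nth 0 s (n'.+1 - i)%N)
  end.
Definition fps_inv (f : fps) : fps := fun n => nth 0 (fps_inv_seq f n) n.

(* (q^a; q^m)_infinity for a, m >= 1: the coefficient of q^n is that of the
   finite product over i <= n (the remaining factors are 1 + O(q^(n+1))). *)
Definition qpoch_trunc (a m N : nat) : {poly rat} :=
  \prod_(i < N) (1 - 'X^(a + m * i)).
Definition qpoch (a m : nat) : fps := fun n => (qpoch_trunc a m n.+1)`_n.

Definition J2 (a m : nat) : fps :=
  fps_mul (qpoch a m) (fps_mul (qpoch (m - a) m) (qpoch m m)).
Definition J1 (m : nat) : fps := qpoch m m.
Definition X (i : nat) : fps := J2 (11 * i) 121.

(* A partition of n is encoded by its multiplicity function:
   mu : {ffun 'I_n -> 'I_n.+1}, mu i = number of parts equal to i+1,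
   subject to sum_i (i+1) * mu i = n. *)
Definition is_partition (n : nat) (mu : {ffun 'I_n -> 'I_n.+1}) : bool :=
  (\sum_(i < n) (i.+1 * mu i)%N == n)%N.

Definition npart (n : nat) : nat :=
  #|[pred mu : {ffun 'I_n -> 'I_n.+1} | is_partition mu]|.

Definition largest_part (n : nat) (mu : {ffun 'I_n -> 'I_n.+1}) : nat :=
  (\max_(i < n | 0 < mu i) i.+1)%N.
Definition ones (n : nat) (mu : {ffun 'I_n -> 'I_n.+1}) : nat :=
  (\sum_(i < n | i == 0 :> nat) mu i)%N.
Definition nlarger (n : nat) (mu : {ffun 'I_n -> 'I_n.+1}) : nat :=
  (\sum_(i < n | ones mu < i.+1) mu i)%N.

Definition crank (n : nat) (mu : {ffun 'I_n -> 'I_n.+1}) : int :=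
  if ones mu == 0%N then (largest_part mu)%:Z
  else (nlarger mu)%:Z - (ones mu)%:Z.

(* M(m,n), with the conventional values for n <= 1 *)
Definition Mcrank (m : int) (n : nat) : int :=
  if (2 <= n)%N then (#|[pred mu : {ffun 'I_n -> 'I_n.+1} | is_partition mu && (crank mu == m)]|)%:Z
  else if n == 0%N then (if m == 0 then 1 else 0)
  else (* n = 1 *) (if m == 0 then -1 else if (m == 1) || (m == -1) then 1 else 0).

(* M(a,r,n) = sum_{m = a mod r} M(m,n); since M(m,n) = 0 for |m| > n,
   the sum ranges over -n <= m <= n. *)
Definition Mmod (a r : int) (n : nat) : int :=
  \sum_(k < (2 * n).+1 | (r %| ((k%:Z - n%:Z) - a))%Z) Mcrank (k%:Z - n%:Z) n.

Definition DC (a : int) : fps :=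
  fun n => (Mmod a 11 n)%:~R - (npart n)%:R / 11%:R.

Definition fps_div (f g : fps) : fps := fps_mul f (fps_inv g).

Definition v11 (a0 a1 a2 a3 a4 a5 a7 a8 a9 a10 : int) : fps :=
  fps_scale (11%:R)^-1 (fps_mul (fps_mul (J1 121) (J1 121))
   (fps_add (fps_scale a0%:~R (fps_inv (X 1)))
   (fps_add (fps_scale a1%:~R (fps_shift 1 (fps_div (X 5) (fps_mul (X 2) (X 3)))))
   (fps_add (fps_scale a2%:~R (fps_shift 2 (fps_div (X 3) (fps_mul (X 1) (X 4)))))
   (fps_add (fps_scale a3%:~R (fps_shift 3 (fps_div (X 2) (fps_mul (X 1) (X 3)))))
   (fps_add (fps_scale a4%:~R (fps_shift 4 (fps_inv (X 2))))
   (fps_add (fps_scale a5%:~R (fps_shift 5 (fps_div (X 4) (fps_mul (X 2) (X 5)))))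
   (fps_add (fps_scale a7%:~R (fps_shift 7 (fps_inv (X 3))))
   (fps_add (fps_scale a8%:~R (fps_shift 19 (fps_div (X 1) (fps_mul (X 4) (X 5)))))
   (fps_add (fps_scale a9%:~R (fps_shift 9 (fps_inv (X 4))))
            (fps_scale a10%:~R (fps_shift 10 (fps_inv (X 5)))))))))))))).

(* Main.v *)
(* Let F(z) = sum M(m,n) z^m q^n = (q)_oo / ((zq)_oo (q/z)_oo) and let z be a
primitive 11th root of unity. Since the product of the (z^k q)_oo over all k
mod 11 is (q^11;q^11)_oo,
    (q^11;q^11)_oo F(z) = (q)_oo^2 prod_(2 <= k <= 9) (z^k q)_oo,
and because {5, 2, 5+2, 5-2} = {2, 3, 4, 5} up to sign mod 11, the right hand
side is a case of Winquist's identity with a = z^5, b = z^2: up to a nonzero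
constant it is alpha(a) beta(b) - (a/b) alpha(b) beta(a) for two single theta
series alpha and beta. Splitting the summation indices mod 11 writes
alpha(z^k) and beta(z^k) as combinations of alpha(Q^x; Q^11) and
beta(Q^x; Q^11), where Q = q^11 and 1 <= x <= 5; in the 2x2 determinant only
the ten antisymmetric combinations with x > y survive, and by Winquist's
identity again each of them is a product of four of the X_i. These are the
ten terms of v11. Averaging over all z recovers M(a,11,n). *)

From HB Require Import structures.
Require Import Defs.
From mathcomp Require Import all_boot all_order all_algebra all_field.
From mathcomp Require Import boolp classical_sets cardinality fsbigop finmap.
From mathcomp Require Import zify ring.
Set Implicit Arguments. Unset Strict Implicit. Unset Printing Implicit Defensive.
Import Order.TTheory GRing.Theory Num.Theory.
Local Open Scope ring_scope.

(** * Formal power series *)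

(** Winquist's identity is derived from the triple product alone. The product of the theta factors
    at ab and a/b splits by parity into [phi] and [psi]; multiplying these by the other two factors
    and splitting modulo 3 gives a 2x2 linear system in [alpha] and [beta], whose coefficients
    [theta3] depend on neither a nor b. The determinant of these coefficients is found by the same
    parity splitting at modulus 3m. A theta series takes a coefficient c and an exponent x: c = z^k,
    x = 0, m = 1 is the root of unity side, c = 1, x = 11 i, m = 121 the X_i side, so one identity
    serves both. Series are sums over integer indices, and a dissection is a bijection of index sets
    plus a comparison of quadratic forms; the price is that finiteness of the fibres must be carried
    along. Infinite objects are compared modulo q^N, and identities are multiplied by series with
    nonzero constant term and then cancelled. The constants of v11 come from ten multipliers c(z)
    with integer coefficients c_k: for the residue r, the entry is 11 c_r minus the sum of the c_k.
    This is Fourier inversion over the ten primitive roots; the remaining root z = 1 yields p(n),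
    which D_C subtracts. *)

Record ps (K : Type) := PS { cf :> nat -> K }.

HB.instance Definition _ (K : Type) := gen_eqMixin (ps K).
HB.instance Definition _ (K : Type) := gen_choiceMixin (ps K).

Lemma psP (K : Type) (f g : ps K) : f =1 g <-> f = g.
Proof. by split=> [|->//]; case: f g => f [g] /= /funext ->. Qed.

Section PowerSeriesRing.
Variable K : fieldType.
Implicit Types f g h : ps K.

Definition ps0 : ps K := PS (fun _ => 0).
Definition ps_add f g := PS (fun n => f n + g n).
Definition ps_opp f := PS (fun n => - f n).
Definition ps1 : ps K := PS (fun n => (n == 0)%:R).
Definition ps_mul f g := PS (fun n => \sum_(i < n.+1) f i * g (n - i)%N).

Let addA : associative ps_add.
Proof. by move=> f g h; apply/psP => n; rewrite /= addrA. Qed.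
Let addC : commutative ps_add.
Proof. by move=> f g; apply/psP => n; rewrite /= addrC. Qed.
Let add0 : left_id ps0 ps_add.
Proof. by move=> f; apply/psP => n; rewrite /= add0r. Qed.
Let addN : left_inverse ps0 ps_opp ps_add.
Proof. by move=> f; apply/psP => n; rewrite /= addNr. Qed.

HB.instance Definition _ := GRing.isZmodule.Build (ps K) addA addC add0 addN.

Definition trunc (n : nat) f : {poly K} := \poly_(i < n.+1) f i.

(* Truncating to polynomials transfers the ring axioms from {poly K}. *)
Let ps_mulE n k f g : (k <= n)%N -> ps_mul f g k = (trunc n f * trunc n g)`_k.
Proof.
move=> kn; rewrite coefM /=; apply: eq_bigr => i _.
have ik : (i <= k)%N by rewrite -ltnS.
by rewrite !coef_poly !ltnS (leq_trans ik kn) (leq_trans (leq_subr _ _) kn).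
Qed.

Let mulC : commutative ps_mul.
Proof. by move=> f g; apply/psP => n; rewrite !(ps_mulE _ _ (leqnn n)) mulrC. Qed.

Let mulA : associative ps_mul.
Proof.
have E n f g : trunc n (ps_mul f g) =
    \poly_(i < n.+1) (trunc n f * trunc n g)`_i.
  by apply/polyP => i; rewrite !coef_poly ltnS; case: leqP => // /ps_mulE ->.
have E2 n f g (p : {poly K}) :
    (trunc n (ps_mul f g) * p)`_n = (trunc n f * trunc n g * p)`_n.
  rewrite E !coefM; apply: eq_bigr => i _.
  by rewrite coef_poly ltn_ord.
move=> f g h; apply/psP => n; rewrite !(ps_mulE _ _ (leqnn n)).
by rewrite [RHS]E2 mulrC E2 mulrC mulrA.
Qed.

Let mul1 : left_id ps1 ps_mul.
Proof.
move=> f; apply/psP => n /=; rewrite big_ord_recl subn0 mul1r big1 ?addr0 // => i _.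
by rewrite /= mul0r.
Qed.

Let mulDl : left_distributive ps_mul ps_add.
Proof.
move=> f g h; apply/psP => n /=; rewrite -big_split /=.
by apply: eq_bigr => i _; rewrite mulrDl.
Qed.

Let one_neq0 : ps1 != ps0.
Proof. by apply/eqP => /psP /(_ 0%N) /= /eqP; rewrite oner_eq0. Qed.

HB.instance Definition _ := GRing.Zmodule_isComNzRing.Build (ps K)
  mulA mulC mul1 mulDl one_neq0.

Lemma cfD f g n : (f + g) n = f n + g n. Proof. by []. Qed.
Lemma cfN f n : (- f) n = - f n. Proof. by []. Qed.
Lemma cfB f g n : (f - g) n = f n - g n. Proof. by []. Qed.
Lemma cfM f g n : (f * g) n = \sum_(i < n.+1) f i * g (n - i)%N.
Proof. by []. Qed.
Lemma cfM0 f g : (f * g) 0%N = f 0%N * g 0%N.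
Proof. by rewrite cfM big_ord1. Qed.
Lemma cf_sum (I : Type) (r : seq I) (P : pred I) (F : I -> ps K) n :
  (\sum_(i <- r | P i) F i) n = \sum_(i <- r | P i) F i n.
Proof. by elim/big_rec2: _ => //= i f1 f2 _ <-. Qed.

Definition mono (c : K) (e : nat) : ps K := PS (fun n => if n == e then c else 0).

Lemma mono_mulE c e f n :
  (mono c e * f) n = if (e <= n)%N then c * f (n - e)%N else 0.
Proof.
rewrite cfM /=; case: leqP => en.
  rewrite (bigD1 (Ordinal (en : (e < n.+1)%N))) //= eqxx big1 ?addr0 // => i.
  by rewrite -val_eqE /= => /negPf ->; rewrite mul0r.
rewrite big1 // => i _; case: eqP => [ie|]; last by rewrite mul0r.
by have := ltn_ord i; rewrite ie; lia.
Qed.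

Lemma monoM c d e e' : mono c e * mono d e' = mono (c * d) (e + e').
Proof.
apply/psP => n; rewrite mono_mulE /=.
have [en|en] := leqP e n; last by case: eqP => // E; lia.
have -> : (n - e == e')%N = (n == (e + e'))%N by apply/eqP/eqP; lia.
by case: ifP => //; rewrite mulr0.
Qed.

Lemma mono1 : mono 1 0 = 1.
Proof. by apply/psP => n; rewrite /= ; case: (n == 0). Qed.

Lemma monoX c e k : mono c e ^+ k = mono (c ^+ k) (e * k).
Proof.
elim: k => [|k IH]; first by rewrite !expr0 muln0 mono1.
by rewrite !exprS IH monoM mulnS.
Qed.

Lemma monoD c d e : mono (c + d) e = mono c e + mono d e.
Proof. by apply/psP => n /=; case: eqP => //; rewrite addr0. Qed.

Lemma monoN c e : mono (- c) e = - mono c e.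
Proof. by apply/psP => n /=; case: eqP => //; rewrite oppr0. Qed.

Lemma mono_sum (I : Type) (r : seq I) (P : pred I) (F : I -> K) e :
  mono (\sum_(i <- r | P i) F i) e = \sum_(i <- r | P i) mono (F i) e.
Proof.
elim/big_rec2: _ => [|i x y _ <-]; last by rewrite monoD.
by apply/psP => n /=; case: eqP.
Qed.

Definition eqmod (N : nat) f g := forall n, (n < N)%N -> f n = g n.

Lemma eqmod_refl N f : eqmod N f f. Proof. by []. Qed.
Lemma eqmod_sym N f g : eqmod N f g -> eqmod N g f.
Proof. by move=> H n /H ->. Qed.
Lemma eqmod_trans N f g h : eqmod N f g -> eqmod N g h -> eqmod N f h.
Proof. by move=> H1 H2 n nN; rewrite H1 ?H2. Qed.
Lemma eqmodD N f f' g g' : eqmod N f f' -> eqmod N g g' -> eqmod N (f + g) (f' + g').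
Proof. by move=> H1 H2 n nN; rewrite !cfD H1 ?H2. Qed.
Lemma eqmodN N f f' : eqmod N f f' -> eqmod N (- f) (- f').
Proof. by move=> H1 n nN; rewrite !cfN H1. Qed.
Lemma eqmodB N f f' g g' : eqmod N f f' -> eqmod N g g' -> eqmod N (f - g) (f' - g').
Proof. by move=> H1 H2; apply/eqmodD/eqmodN. Qed.
Lemma eqmodM N f f' g g' : eqmod N f f' -> eqmod N g g' -> eqmod N (f * g) (f' * g').
Proof.
move=> H1 H2 n nN; rewrite !cfM; apply: eq_bigr => i _.
by rewrite H1 ?H2 //; have := ltn_ord i; lia.
Qed.
Lemma eqmod_sum N (I : eqType) (r : seq I) (F G : I -> ps K) :
  (forall i, i \in r -> eqmod N (F i) (G i)) ->
  eqmod N (\sum_(i <- r) F i) (\sum_(i <- r) G i).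
Proof.
move=> H n nN; rewrite !cf_sum !big_seq; apply: eq_bigr => i ir.
exact: H.
Qed.
Lemma eqmod_prod N (I : eqType) (r : seq I) (F G : I -> ps K) :
  (forall i, i \in r -> eqmod N (F i) (G i)) ->
  eqmod N (\prod_(i <- r) F i) (\prod_(i <- r) G i).
Proof.
elim: r => [|i r IH] H; first by rewrite !big_nil.
rewrite !big_cons; apply: eqmodM; first by apply: H; rewrite mem_head.
by apply: IH => j jr; apply: H; rewrite inE jr orbT.
Qed.
Lemma eqmod_mono0 N c e f : (N <= e)%N -> eqmod N (mono c e * f) 0.
Proof. by move=> Ne n nN; rewrite mono_mulE leqNgt (leq_trans nN Ne). Qed.
Lemma eqmodP f g : (forall N, eqmod N f g) -> f = g.
Proof. by move=> H; apply/psP => n; apply: (H n.+1). Qed.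

(** Coefficient n of [h * f] is [h 0 * f n] plus terms in earlier coefficients of f, so induction on
    n cancels h. This is how later proofs divide by infinite products. *)
Lemma ps_regular h f g N : h 0%N != 0 -> eqmod N (h * f) (h * g) -> eqmod N f g.
Proof.
move=> h0 E n; elim/ltn_ind: n => n IH nN.
have := E n nN; rewrite !cfM 2!big_ord_recl /= !subn0.
have -> : \sum_(i < n) h (bump 0 i) * f (n - bump 0 i)%N
    = \sum_(i < n) h (bump 0 i) * g (n - bump 0 i)%N.
  by apply: eq_bigr => i _; rewrite IH // /bump /=; have := ltn_ord i; lia.
by move/addIr/(mulfI h0).
Qed.

Lemma ps_mulI h f g : h 0%N != 0 -> h * f = h * g -> f = g.
Proof.
by move=> h0 E; apply: eqmodP => N; apply: ps_regular h0 _; rewrite E.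
Qed.

End PowerSeriesRing.

(** * Formal sums of monomials *)

Section FormalSums.
Variable K : fieldType.

(* sum_i c_i q^(e_i); only meaningful when every fibre of e is finite, since a
   finitely supported big operator with infinite support is 0. *)
Definition ser (I : choiceType) (c : I -> K) (e : I -> int) : ps K :=
  PS (fun N : nat => \sum_(i \in [set i : I | e i = N%:Z]%classic) c i).
Arguments ser : simpl never.

(** Nonnegative exponents together with a finite bound on all indices of exponent at most N are
    stable under products of index sets, which finiteness of the individual fibres is not. *)
Definition proper (I : choiceType) (e : I -> int) : Prop :=
  (forall i, 0 <= e i) /\
  (forall N : nat, exists r : seq I, forall i, e i <= N%:Z -> i \in r).

Lemma ser_fin (I : choiceType) (c : I -> K) (e : I -> int) (r : seq I) (N : nat) :
  uniq r -> (forall i, e i = N%:Z -> i \in r) ->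
  ser c e N = \sum_(i <- r | e i == N%:Z) c i.
Proof.
move=> ur Hr; rewrite bigfs //; last first.
  by move=> i /eqP ei; rewrite Hr.
rewrite /ser /=; apply: eq_fsbigl; apply/predeqP => i /=; split=> [ei|/eqP //].
by rewrite /in_mem /= ei.
Qed.

Lemma proper_seq (I : choiceType) (e : I -> int) (N : nat) : proper e ->
  exists2 r : seq I, uniq r & forall i, e i <= N%:Z -> i \in r.
Proof.
case=> _ /(_ N) [r Hr]; exists (undup r); first exact: undup_uniq.
by move=> i /Hr; rewrite mem_undup.
Qed.

Lemma eq_ser (I : choiceType) (c c' : I -> K) (e e' : I -> int) :
  c =1 c' -> e =1 e' -> ser c e = ser c' e'.
Proof. by move=> /funext -> /funext ->. Qed.

Lemma ser_bij (I J : choiceType) (h : J -> I) (c : I -> K) (e : I -> int) :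
  bijective h -> ser c e = ser (c \o h) (e \o h).
Proof.
case=> g hK gK; apply/psP => N /=; apply: reindex_fsbig; split.
- by move=> j /=.
- by move=> i j _ _ /(can_inj hK).
- by move=> i /= Hi; exists (g i); rewrite ?gK.
Qed.

Lemma proper_inj (I J : choiceType) (h : J -> I) (e : I -> int) :
  injective h -> proper e -> proper (e \o h).
Proof.
move=> hI [e0 fin]; split=> [j|N]; first exact: e0.
have [r Hr] := fin N.
(* A partial inverse of h, obtained by choice, pulls the finite list of indices back to J. *)
have [g gK] : exists g : I -> option J, forall j, g (h j) = Some j.
  have H i : exists o : option J, forall j, h j = i -> o = Some j.
    have [[j <-]|nj] := EM (exists j, h j = i).
      by exists (Some j) => j' /hI ->.
    by exists None => j ji; case: nj; exists j.
  by have [g Hg] := choice H; exists g => j; apply: Hg.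
exists (pmap g r) => j /Hr jr.
by rewrite mem_pmap -gK map_f.
Qed.

Lemma proper_pair (I J : choiceType) (e : I -> int) (e' : J -> int) :
  proper e -> proper e' -> proper (fun p : I * J => e p.1 + e' p.2).
Proof.
move=> [e0 fin] [e0' fin']; split=> [p|N]; first by rewrite addr_ge0.
have [r Hr] := fin N; have [r' Hr'] := fin' N.
exists [seq (i, j) | i <- r, j <- r'] => -[i j] /= ij.
have := e0 i; have := e0' j; move=> ? ?.
by apply/allpairsP; exists (i, j); split=> //=; [apply: Hr|apply: Hr']; lia.
Qed.

Lemma serM (I J : choiceType) (c : I -> K) (c' : J -> K) e e' :
  proper e -> proper e' ->
  ser c e * ser c' e' =
  ser (fun p : I * J => c p.1 * c' p.2) (fun p => e p.1 + e' p.2).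
Proof.
move=> pe pe'; apply/psP => N; rewrite cfM.
have [r ur Hr] := proper_seq N pe; have [r' ur' Hr'] := proper_seq N pe'.
rewrite (ser_fin _ (r := [seq (i, j) | i <- r, j <- r'])); first last.
- case=> i j /= ij; apply/allpairsP; exists (i, j); case: pe pe' => e0 _ [e0' _].
  have := e0 i; have := e0' j; move=> ? ?.
  by split=> //=; [apply: Hr|apply: Hr']; lia.
- by apply: allpairs_uniq => // -[? ?] [? ?] _ _ [-> ->].
rewrite [RHS]big_mkcond big_allpairs_dep.
(* Both sides run over one finite rectangle of pairs; a pair whose exponents add up to N is met for
   the single value k = e i. *)
transitivity (\sum_(k < N.+1) \sum_(i <- r) \sum_(j <- r')
    if (e i == k%:Z) && (e' j == (N - k)%N%:Z) then c i * c' j else 0).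
  apply: eq_bigr => k _.
  rewrite (ser_fin _ (r := r)) //; last first.
    by move=> i E; apply: Hr; rewrite E; have := ltn_ord k; lia.
  rewrite (ser_fin _ (r := r')) //; last first.
    by move=> i E; apply: Hr'; rewrite E; have := ltn_ord k; lia.
  rewrite big_mkcond [X in _ * X]big_mkcond mulr_suml; apply: eq_bigr => i _.
  rewrite mulr_sumr; apply: eq_bigr => j _.
  by do 2 case: eqP => _; rewrite ?mul0r ?mulr0.
rewrite exchange_big; apply: eq_bigr => i _.
rewrite exchange_big; apply: eq_bigr => j _ /=.
have := pe.1 i; case: (e i) => // a _.
have := pe'.1 j; case: (e' j) => // b _.
have [E|E] := eqVneq (a + b)%N N.
  have -> : (Posz a + Posz b == Posz N) by rewrite -E.
  have aN : (a < N.+1)%N by lia.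
  rewrite (bigD1 (Ordinal aN)) //= big1 ?addr0 => [|k].
    by rewrite eqxx; case: eqP => // H; case: H; congr Posz; lia.
  rewrite -val_eqE /= => /eqP ka; case: eqP => //= -[H].
  by case: ka.
have -> : (Posz a + Posz b == Posz N) = false.
  by apply/eqP => -[H]; rewrite H eqxx in E.
rewrite big1 // => k _; case: eqP => //= -[ak]; case: eqP => // -[bk].
by move/eqP: E; have := ltn_ord k; lia.
Qed.

Lemma ser_mono (I : choiceType) (d : K) (k : nat) (c : I -> K) e : proper e ->
  mono d k * ser c e = ser (fun i => d * c i) (fun i => k%:Z + e i).
Proof.
move=> pe.
have E : mono d k = ser (fun _ : unit => d) (fun _ => k%:Z).
  apply/psP => N; rewrite (ser_fin _ (r := [:: tt])) //.
  by rewrite big_mkcond big_seq1 /= eqz_nat eq_sym.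
have pk : proper (fun _ : unit => k%:Z) by split=> // N; exists [:: tt] => -[].
rewrite E serM // [LHS](@ser_bij _ _ (fun i : I => (tt, i))) //.
by exists snd => // -[[] ?].
Qed.

Lemma serN (I : choiceType) (c : I -> K) e : proper e ->
  - ser c e = ser (fun i => - c i) e.
Proof.
move=> pe; rewrite -mulN1r -(mono1 K) -monoN ser_mono //.
by apply: eq_ser => i; rewrite ?mulN1r ?add0r.
Qed.

Lemma ser_slices (F : finType) (I : choiceType) (c : F * I -> K) e : proper e ->
  ser c e = \sum_(f : F) ser (fun i => c (f, i)) (fun i => e (f, i)).
Proof.
move=> pe; apply/psP => N; have [r ur Hr] := proper_seq N pe.
rewrite cf_sum.
pose r' := undup (map snd r).
have Hr' f i : e (f, i) = N -> i \in r'.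
  by move=> E; rewrite mem_undup; apply/mapP; exists (f, i) => //; apply: Hr; rewrite E.
rewrite (ser_fin _ (r := [seq (f, i) | f <- enum F, i <- r'])); first last.
- by move=> [f i] /Hr' ir; apply/allpairsP; exists (f, i); rewrite mem_enum.
- by apply: allpairs_uniq; rewrite ?enum_uniq ?undup_uniq // => -[? ?] [? ?] _ _ [-> ->].
rewrite big_mkcond big_allpairs_dep big_enum; apply: eq_bigr => f _.
by rewrite (ser_fin _ (r := r')) ?undup_uniq //; [rewrite -big_mkcond|apply: Hr'].
Qed.

(** The linear bound confines the indices of exponent at most N to the interval from -(N + C) to N +
    C. *)
Lemma properW (e : int -> int) :
  (forall n, 0 <= e n) -> (exists C : nat, forall n, `|n| <= e n + C%:Z) -> proper e.
Proof.
move=> e0 [C HC]; split=> // N.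
exists (map (fun i : nat => i%:Z - (N + C)%:Z) (iota 0 (2 * (N + C)).+1)) => n en.
apply/mapP; exists (absz (n + (N + C)%:Z)); have := HC n => ?.
  by rewrite mem_iota; lia.
lia.
Qed.

End FormalSums.

(** * Infinite products and Gaussian binomials *)

Section InfiniteProducts.
Variable K : fieldType.
Implicit Types (u v : nat -> ps K) (N M : nat).

(** Reading coefficient n from the first n + 1 factors is justified under [near1]: factor i is then
    1 + O(q^i) and leaves the coefficients below i alone. *)
Definition iprod u : ps K := PS (fun n => (\prod_(i < n.+1) u i) n).

Definition near1 u := forall i, eqmod i (u i) 1.

Lemma near1M u v : near1 u -> near1 v -> near1 (fun i => u i * v i).
Proof. by move=> Hu Hv i; rewrite -[1]mul1r; apply: eqmodM. Qed.

Lemma iprod_approx u N M : near1 u -> (N <= M)%N ->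
  eqmod N (\prod_(i < M) u i) (iprod u).
Proof.
move=> Hu NM n nN; rewrite /iprod /=.
have {NM nN} nM : (n < M)%N by apply: leq_trans NM.
elim: M nM => // M IH; rewrite ltnS leq_eqVlt => /orP[/eqP -> //|nM].
rewrite big_ord_recr /= -IH //; set f := \prod_(i < M) u i.
rewrite -[in RHS](mulr1 f); apply: (eqmodM (N := M)) => //; exact: Hu.
Qed.

Lemma eq_iprod u v : u =1 v -> iprod u = iprod v.
Proof. by move=> uv; apply/psP => n /=; under eq_bigr do rewrite uv. Qed.

Lemma iprodM u v : near1 u -> near1 v ->
  iprod (fun i => u i * v i) = iprod u * iprod v.
Proof.
move=> Hu Hv; apply: eqmodP => N.
apply: eqmod_trans (eqmod_sym (iprod_approx (near1M Hu Hv) (leqnn N))) _.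
by rewrite big_split; apply: eqmodM; apply: iprod_approx.
Qed.

Lemma iprod_recl u : near1 u -> near1 (u \o S) -> iprod u = u 0%N * iprod (u \o S).
Proof.
move=> Hu Hv; apply: eqmodP => N.
apply: eqmod_trans (eqmod_sym (iprod_approx Hu (leqnSn N))) _.
rewrite big_ord_recl; apply: eqmodM => //; exact: iprod_approx.
Qed.

Definition qfac (c : K) (a m i : nat) : ps K := 1 - mono c (a + m * i).
Definition qp (c : K) (a m : nat) : ps K := iprod (qfac c a m).

Lemma near1_qfac c a m : (0 < m)%N -> near1 (qfac c a m).
Proof.
move=> m0 i n ni; rewrite cfB [mono _ _ n]/=.
by have -> : (n == a + m * i)%N = false by [apply/eqP; nia]; rewrite subr0.
Qed.

Lemma qp_recl c a m : (0 < m)%N -> qp c a m = (1 - mono c a) * qp c (a + m) m.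
Proof.
move=> m0; rewrite /qp iprod_recl; [|exact: near1_qfac|].
  by rewrite {1}/qfac muln0 addn0; congr (_ * _); apply: eq_iprod => i; rewrite /qfac /= mulnS addnA.
move=> i n ni; rewrite /=; apply: near1_qfac => //; lia.
Qed.

Lemma qp_cf0 c a m : (0 < a)%N -> qp c a m 0%N = 1.
Proof.
move=> a0; rewrite /= big_ord1 /qfac cfB [mono _ _ _]/= muln0 addn0.
by rewrite eq_sym (gtn_eqF a0) subr0.
Qed.

Lemma prod_nat_mul (R : comNzRingType) (f : nat -> R) d N :
  \prod_(i < N * d) f i = \prod_(i < N) \prod_(r < d) f (i * d + r)%N.
Proof.
elim: N => [|N IH]; first by rewrite !big_ord0.
rewrite [RHS]big_ord_recr /= -IH mulSnr -!(big_mkord xpredT f).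
rewrite (big_cat_nat _ (n := (N * d)%N)) //= ?leq_addr //; congr (_ * _).
by rewrite -{1}[(N * d)%N]add0n big_addn addKn big_mkord; apply: eq_bigr => i _; rewrite addnC.
Qed.

Lemma qp_split d c a m : (0 < d)%N -> (0 < m)%N ->
  qp c a m = \prod_(r < d) qp c (a + m * r) (m * d).
Proof.
move=> d0 m0; apply: eqmodP => N.
have NN : (N <= N * d)%N by rewrite leq_pmulr.
apply: eqmod_trans (eqmod_sym (iprod_approx (near1_qfac _ _ m0) NN)) _.
rewrite prod_nat_mul exchange_big /=; apply: eqmod_prod => r _.
have E : (0 < m * d)%N by rewrite muln_gt0 m0.
rewrite (eq_bigr (fun i : 'I_N => qfac c (a + m * r) (m * d) i)) => [|i _].
  by apply: iprod_approx; first exact: near1_qfac.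
by rewrite /qfac; congr (1 - mono c _); nia.
Qed.

End InfiniteProducts.

Section GaussianBinomials.
Variables (R : comNzRingType) (p : R).

Fixpoint gauss (n k : nat) : R :=
  match n, k with
  | _, 0 => 1
  | 0, _.+1 => 0
  | n'.+1, k'.+1 => gauss n' k' + p ^+ k'.+1 * gauss n' k'.+1
  end.

Lemma gauss0 n : gauss n 0 = 1. Proof. by case: n. Qed.
Lemma gaussS n k : gauss n.+1 k.+1 = gauss n k + p ^+ k.+1 * gauss n k.+1.
Proof. by []. Qed.
Lemma gauss_small n k : (n < k)%N -> gauss n k = 0.
Proof.
elim: n k => [|n IH] [|k] //= nk.
by rewrite !IH ?mulr0 ?addr0 //; lia.
Qed.

(** The mirror image of the q-Pascal rule that defines [gauss]; the induction expands both terms of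
    the defining rule. *)
Lemma gaussS_left n k : (k <= n)%N ->
  gauss n.+1 k.+1 = p ^+ (n - k) * gauss n k + gauss n k.+1.
Proof.
elim: n k => [|n IH] [|k] kn //.
- by rewrite /= expr0 mulr0; ring.
- have := IH 0%N isT; rewrite !subn0 !gauss0 mulr1 => E.
  rewrite gaussS E gauss0 (exprS p n) expr1; move: E; rewrite gaussS gauss0 expr1.
  move: (p ^+ n) (gauss n 1) => x y /eqP; rewrite -subr_eq => /eqP <-.
  by ring.
have [kn'|] := ltnP k n; last first.
  move=> nk; have {nk kn} -> : k = n by lia.
  by rewrite gaussS subnn expr0 mul1r (@gauss_small n.+1 n.+2) // mulr0.
have E1 := IH k (ltnW kn'); have E2 := IH k.+1 kn'.
rewrite [LHS]gaussS {1}E1 {1}E2 !gaussS.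
have -> : (n.+1 - k.+1 = n - k)%N by lia.
have -> : (n - k = (n - k.+1).+1)%N by lia.
by rewrite !exprS; ring.
Qed.

Definition pfact (n : nat) : R := \prod_(i < n) (1 - p ^+ i.+1).

Lemma pfactS n : pfact n.+1 = pfact n * (1 - p ^+ n.+1).
Proof. by rewrite /pfact big_ord_recr. Qed.

Lemma gauss_fact n k : (k <= n)%N -> gauss n k * (pfact k * pfact (n - k)) = pfact n.
Proof.
elim: n k => [|n IH] [|k] // kn.
- by rewrite /pfact !big_ord0 !mulr1.
- by rewrite gauss0 mul1r subn0 /pfact big_ord0 mul1r.
rewrite gaussS subSS pfactS [RHS]pfactS.
have E1 := IH k kn.
have [kn'|nk] := ltnP k n; last first.
  have E0 : k = n by lia.
  move: E1; rewrite E0 => E1.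
  by rewrite (@gauss_small n n.+1) // -[X in _ = X * _]E1; ring.
have := IH k.+1 kn'; have -> : (n - k = (n - k.+1).+1)%N by lia.
rewrite !pfactS => E2.
move: E1; have -> : (n - k = (n - k.+1).+1)%N by lia.
rewrite pfactS => E1.
have -> : n.+1 = (k.+1 + (n - k.+1).+1)%N by lia.
set x := p ^+ k.+1 in E1 E2 *; set y := p ^+ (n - k.+1).+1 in E1 E2 *.
rewrite exprD -/x -/y.
(* The splitting 1 - xy = (1 - x) + x (1 - y) distributes the new factor over the two terms of the
   Pascal rule. *)
have -> : pfact n * (1 - x * y) = pfact n * (1 - x) + x * pfact n * (1 - y) by ring.
by rewrite -{1}E1 -E2; ring.
Qed.

End GaussianBinomials.
Arguments gauss : simpl never.

(** * Jacobi's triple product *)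

(** One Pascal rule of each kind leads from row n to row n + 2. Their cross power p^(j+2) p^(n-j-1)
    = p^(n+1) is the one that appears when the two factors gained by the finite triple product are
    multiplied. *)
Lemma gaussSS (R : comNzRingType) (p : R) n j : (j <= n)%N ->
  gauss p n.+2 j.+2 =
  p ^+ (n - j) * gauss p n j + (1 + p ^+ n.+1) * gauss p n j.+1
  + p ^+ j.+2 * gauss p n j.+2.
Proof.
rewrite leq_eqVlt => /orP[/eqP ->|jn].
  rewrite gaussS (@gauss_small _ _ n.+1 n.+2) // (@gauss_small _ _ n n.+2) //.
  by rewrite gaussS_left // (@gauss_small _ _ n n.+1) // !mulr0 !addr0.
rewrite gaussS gaussS_left 1?ltnW // gaussS_left //.
have -> : n.+1 = (j.+2 + (n - j.+1))%N by lia.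
by rewrite exprD; ring.
Qed.

Definition tri (n : int) : int := (n * (n - 1) %/ 2)%Z.

Lemma tri2 n : 2 * tri n = n * (n - 1).
Proof.
have d2 : (2 %| n * (n - 1))%Z.
  have [E|E] : n = 2 * (n %/ 2)%Z \/ n = 2 * (n %/ 2)%Z + 1 by lia.
    by rewrite E dvdz_mulr // dvdz_mulr.
  by rewrite {2}E dvdz_mull // addrK dvdz_mulr.
by rewrite mulrC /tri divzK.
Qed.

Lemma tri_ge0 n : 0 <= tri n.
Proof. have := tri2 n; nia. Qed.

(** For n > 0 the triangular term suffices. For n <= 0, [x <= m] gives x n >= m n, and the
    triangular number tri n + n takes over. *)
Lemma jexp_ge (x m : nat) n : (0 < m)%N -> (x <= m)%N ->
  `|n| <= x%:Z * n + m%:Z * tri n + 1.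
Proof.
move=> m0 xm; have T := tri2 n; have T0 := tri_ge0 n.
have T1 : n - 1 <= tri n by nia.
have T2 : 0 <= tri n + n by nia.
have T3 : - n - 1 <= tri n + n by nia.
have [n0|n0] : 0 < n \/ n <= 0 by lia.
  have : 0 <= x%:Z * n by nia.
  have : tri n <= m%:Z * tri n by nia.
  by lia.
have : m%:Z * n <= x%:Z * n by nia.
have : tri n + n <= m%:Z * (tri n + n) by nia.
by rewrite mulrDr; lia.
Qed.

Lemma tri1 n : tri (n + 1) = tri n + n.
Proof. by have := tri2 n; have := tri2 (n + 1); lia. Qed.

Section JacobiTripleProduct.
Variables (x m : nat).
Hypotheses (m0 : (0 < m)%N) (xm : (x <= m)%N).

Definition jexp (n : int) : int := x%:Z * n + m%:Z * tri n.

Lemma jexp_ge0 n : 0 <= jexp n.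
Proof.
have := jexp_ge n m0 xm; rewrite -/(jexp n).
have [->|n0] := eqVneq n 0; last by lia.
by rewrite /jexp mulr0 add0r (_ : tri 0 = 0) ?mulr0.
Qed.

Lemma proper_jexp : proper jexp.
Proof.
apply: properW jexp_ge0 _; exists 1%N => n; exact: jexp_ge.
Qed.

Variables (K : fieldType) (c : K).
Hypothesis (c0 : c != 0).

Definition jac : ps K := ser (fun n : int => (-1) ^ n * c ^ n) jexp.

Let t (k : int) : ps K := mono (c ^ k) (absz (jexp k)).
Let p : ps K := mono 1 m.

Let pX n : p ^+ n = mono 1 (m * n).
Proof. by rewrite monoX expr1n. Qed.

(** Each new factor of the finite product moves a theta monomial to a neighbouring index at the cost
    of a power of p; [vt] moves it the other way. *)
Let ut N (k : int) : k <= N%:Z ->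
  mono c (x + m * N) * t k = p ^+ absz (N%:Z - k) * t (k + 1).
Proof.
move=> kN; rewrite pX !monoM mul1r expfzDr // expr1z mulrC; congr (mono _ _).
have := jexp_ge0 k; have := jexp_ge0 (k + 1); rewrite /jexp tri1.
by move=> *; nia.
Qed.

Let vt N (k : int) : - N%:Z <= k ->
  mono c^-1 (m - x + m * N) * t k = p ^+ absz (N%:Z + k) * t (k - 1).
Proof.
move=> kN; rewrite pX !monoM mul1r expfzDr // mulrC -[in c^-1](expr1z c) invr_expz; congr (mono _ _).
have := tri1 (k - 1); rewrite subrK => E.
have := jexp_ge0 k; have := jexp_ge0 (k - 1); rewrite /jexp E.
by move=> *; nia.
Qed.

Let sum_shift (F : nat -> ps K) n : F n.+1 = 0 ->
  \sum_(j < n.+1) F j = F 0%N + \sum_(j < n.+1) F j.+1.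
Proof.
move=> F0; rewrite big_ord_recl; congr (_ + _).
by rewrite [RHS]big_ord_recr /= F0 addr0.
Qed.

(* The coefficient recurrence is the q-Pascal rule used twice (gaussSS). *)
Lemma finite_jtp N :
  \prod_(i < N) (qfac c x m i * qfac c^-1 (m - x) m i) =
  \sum_(j < (2 * N).+1) (-1) ^+ (j + N) * t (j%:Z - N%:Z) * gauss p (2 * N) j.
Proof.
elim: N => [|N IH].
  rewrite big_ord0 big_ord1 /= expr0 mul1r mulr1 /t subrr expr0z.
  by rewrite (_ : jexp 0 = 0) ?mono1 // /jexp mulr0 add0r (_ : tri 0 = 0) ?mulr0.
rewrite big_ord_recr /= IH {IH}.
have -> : qfac c x m N * qfac c^-1 (m - x) m N
   = 1 + p ^+ (2 * N).+1 - mono c (x + m * N) - mono c^-1 (m - x + m * N).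
  rewrite /qfac mulrBl mul1r mulrBr mulr1 monoM divff // pX.
  have -> : (x + m * N + (m - x + m * N) = m * (2 * N).+1)%N by nia.
  by ring.
have -> : (2 * N.+1 = (2 * N).+2)%N by lia.
rewrite [RHS]big_ord_recl [X in _ = _ + X]big_ord_recl mulr_suml.
set n := (2 * N)%N.
(* [A], [B] and [C] collect the terms whose theta index goes up by one, stays, or goes down by one.
   After reindexing, [A j], [B j.+1] and [C j.+2] carry the same monomial and are joined by
   [gaussSS]. *)
pose B (j : nat) := (-1) ^+ (j + N) * t (j%:Z - N%:Z) * ((1 + p ^+ n.+1) * gauss p n j).
pose C (j : nat) := - ((-1) ^+ (j + N) * t (j%:Z - N%:Z - 1) * (p ^+ j * gauss p n j)).
pose A (j : nat) := - ((-1) ^+ (j + N) * t (j%:Z - N%:Z + 1) * (p ^+ (n - j) * gauss p n j)).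
transitivity (\sum_(j < n.+1) A j + \sum_(j < n.+1) B j + \sum_(j < n.+1) C j).
  rewrite -!big_split; apply: eq_bigr => j _ /=.
  rewrite /A /B /C; have jn := ltn_ord j.
  have := @ut N (j%:Z - N%:Z); have := @vt N (j%:Z - N%:Z).
  have -> : absz (N%:Z + (j%:Z - N%:Z))%R = j by lia.
  have -> : absz (N%:Z - (j%:Z - N%:Z))%R = (n - j)%N by lia.
  move=> /(_ ltac:(lia)) Hv /(_ ltac:(lia)) Hu.
  move: (mono c _) (mono c^-1 _) Hu Hv => u v Hu Hv.
  transitivity ((-1) ^+ (j + N) * gauss p n j * ((1 + p ^+ n.+1) * t (j%:Z - N%:Z) - u * t (j%:Z - N%:Z) - v * t (j%:Z - N%:Z))).
    by ring.
  by rewrite Hu Hv; ring.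
have gn : gauss p n n.+1 = 0 by rewrite gauss_small.
rewrite [X in _ + X + _]sum_shift; last by rewrite /B gn !mulr0.
rewrite [X in _ + X]sum_shift; last by rewrite /C gn !mulr0 oppr0.
rewrite (@sum_shift (fun j => C j.+1)); last by rewrite /C gauss_small ?mulr0 ?oppr0.
rewrite -addrA [LHS]addrCA.
transitivity (C 0%N + (B 0%N + C 1%N + \sum_(j < n.+1) (A j + B j.+1 + C j.+2))).
  by rewrite !big_split /=; ring.
congr (_ + (_ + _)).
- rewrite /C /= !gauss0 !add0n expr0 /=.
  have -> : 0%:Z - N%:Z - 1 = 0%:Z - N.+1%:Z by lia.
  by rewrite exprS; ring.
- rewrite /B /C /= /bump /= gaussS gauss0 gaussS_left // gauss0 subn0.
  have -> : 0%:Z - N%:Z = 1%:Z - N.+1%:Z by lia.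
  have -> : 1%:Z - N%:Z - 1 = 1%:Z - N.+1%:Z by lia.
  by rewrite !addSn !add0n !exprS expr0 gauss0; ring.
- apply: eq_bigr => j _; rewrite /A /B /C /= /bump /= !add1n.
  have jn : (j <= n)%N by have := ltn_ord j; lia.
  rewrite gaussSS //.
  have -> : j%:Z - N%:Z + 1 = j.+2%:Z - N.+1%:Z by lia.
  have -> : j.+1%:Z - N%:Z = j.+2%:Z - N.+1%:Z by lia.
  have -> : j.+2%:Z - N%:Z - 1 = j.+2%:Z - N.+1%:Z by lia.
  by rewrite !addSn !addnS !exprS; ring.
Qed.

Let pfactE L : pfact p L = \prod_(i < L) qfac 1 m m i.
Proof. by apply: eq_bigr => i _; rewrite pX mulnS. Qed.

(** In [gauss_fact] all three factorials have at least M factors, hence agree with the infinite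
    product modulo q^M, and one copy cancels. *)
Let gauss_lim M L j : (M <= j)%N -> (M + j <= L)%N -> eqmod M (gauss p L j * qp 1 m m) 1.
Proof.
move=> Mj MjL; apply: (ps_regular (h := qp 1 m m)); first by rewrite qp_cf0 ?oner_eq0.
have lim i : (M <= i)%N -> eqmod M (pfact p i) (qp 1 m m).
  by move=> Mi; rewrite pfactE; apply: iprod_approx => //; apply: near1_qfac.
rewrite mulr1; apply: eqmod_trans (lim L _); last by lia.
have jL : (j <= L)%N by lia.
rewrite -(gauss_fact p jL) mulrC -mulrA.
by apply: eqmodM => //; apply: eqmodM; apply/eqmod_sym/lim => //; lia.
Qed.

Theorem jacobi_triple_product : qp c x m * qp c^-1 (m - x) m * qp 1 m m = jac.
Proof.
(* The term of index k = j - N has exponent at least |k| - 1. With N = 2M + 1 the Gaussian binomial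
   is stable modulo q^M except where |k| > M + 1, and there the term itself vanishes modulo q^M. *)
apply: eqmodP => M; set N := (2 * M).+1.
have n1 := near1_qfac c x m0; have n2 := near1_qfac c^-1 (m - x) m0.
pose S := \sum_(j < (2 * N).+1) (-1) ^+ (j + N) * t (j%:Z - N%:Z).
apply: (@eqmod_trans _ _ _ S).
  rewrite -iprodM //; apply: (@eqmod_trans _ _ _ (\prod_(i < N) (qfac c x m i * qfac c^-1 (m - x) m i) * qp 1 m m)).
    apply: eqmodM => //; apply/eqmod_sym/iprod_approx; [exact: near1M|lia].
  rewrite finite_jtp /S mulr_suml; apply: eqmod_sum => j _.
  set a := _ * t _; rewrite -[a * _ * _]mulrA -[X in eqmod _ _ X]mulr1 /a.
  have jN := ltn_ord j.
  have [small|big] := boolP ((M <= j) && (M + j <= 2 * N))%N.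
    case/andP: small => Ma Mb; apply: eqmodM => //; by apply: gauss_lim.
  rewrite ![_ * t _]mulrC -!mulrA.
  have J := jexp_ge (j%:Z - N%:Z) m0 xm; rewrite -/(jexp _) in J.
  have e : (M <= absz (jexp (j%:Z - N%:Z)))%N by move: big; lia.
  by apply: eqmod_trans (eqmod_mono0 _ _ e) (eqmod_sym (eqmod_mono0 _ _ e)).
move=> n nM.
rewrite /jac (ser_fin _ (r := [seq i%:Z - N%:Z | i <- iota 0 (2 * N).+1])); first last.
- move=> k Hk; apply/mapP; exists (absz (k + N%:Z)%R).
    by have := jexp_ge k m0 xm; rewrite -/(jexp k) Hk mem_iota; lia.
  by have := jexp_ge k m0 xm; rewrite -/(jexp k) Hk; lia.
- by rewrite map_inj_uniq ?iota_uniq // => a b; lia.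
rewrite big_mkcond big_map -{1}[(2 * N).+1]subn0 -/(index_iota _ _) big_mkord /S cf_sum.
apply: eq_bigr => j _.
have -> : (-1) ^+ (j + N) = mono ((-1) ^+ (j + N)) 0 :> ps K.
  by rewrite -[in LHS](mono1 K) -monoN monoX.
have J0 := jexp_ge0 (j%:Z - N%:Z).
rewrite monoM add0n /= -eqz_nat abszE ger0_norm // eq_sym; congr (if _ then _ * _ else _).
by rewrite expfzDr ?oppr_eq0 ?oner_eq0 // -exprnN -exprnP invr_sign exprD.
Qed.

End JacobiTripleProduct.

(** * Theta series of level three *)

Section MonomialFamilies.
Variables (K : fieldType) (a b : K) (x y m : nat).
Hypotheses (a0 : a != 0) (b0 : b != 0).

(* The formal sum of (-1)^U A^S B^T p^R with A = a q^x, B = b q^y and p = q^m,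
   so that one computation covers both roots of unity and powers of q. *)
Definition fam (I : choiceType) (U S T R : I -> int) : ps K :=
  ser (fun i => (-1) ^ U i * a ^ S i * b ^ T i)
      (fun i => x%:Z * S i + y%:Z * T i + m%:Z * R i).

Definition pfam (I : choiceType) (S T R : I -> int) : Prop :=
  proper (fun i => x%:Z * S i + y%:Z * T i + m%:Z * R i).

Lemma fam_eq (I : choiceType) (U S T R U' S' T' R' : I -> int) :
  (forall i, (2 %| U i - U' i)%Z) -> S =1 S' -> T =1 T' -> R =1 R' ->
  fam U S T R = fam U' S' T' R'.
Proof.
move=> HU HS HT HR; apply: eq_ser => i; rewrite HS HT ?HR //.
have /dvdzP [k E] := HU i; congr (_ * _ * _).
have -> : U i = k * 2 + U' i by rewrite -E subrK.
rewrite expfzDr ?oppr_eq0 ?oner_eq0 // mulrC [in X in _ * X]mulrC -exprz_exp.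
by rewrite (_ : (-1) ^ 2 = 1 :> K) ?exp1rz ?mulr1 // -exprnP sqrrN expr1n.
Qed.

Lemma fam_mul (I J : choiceType) (U S T R : I -> int) (U' S' T' R' : J -> int) :
  pfam S T R -> pfam S' T' R' ->
  fam U S T R * fam U' S' T' R' =
  fam (fun p : I * J => U p.1 + U' p.2) (fun p => S p.1 + S' p.2)
      (fun p => T p.1 + T' p.2) (fun p => R p.1 + R' p.2).
Proof.
move=> p1 p2; rewrite /fam serM //; apply: eq_ser => -[i j] /=; last by ring.
by rewrite !expfzDr ?oppr_eq0 ?oner_eq0 //; ring.
Qed.

Lemma pfam_mul (I J : choiceType) (S T R : I -> int) (S' T' R' : J -> int) :
  pfam S T R -> pfam S' T' R' ->
  pfam (fun p : I * J => S p.1 + S' p.2)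
      (fun p => T p.1 + T' p.2) (fun p => R p.1 + R' p.2).
Proof.
move=> p1 p2; have := proper_pair p1 p2; rewrite /pfam.
by congr proper; apply: boolp.funext => -[i j] /=; ring.
Qed.

Lemma fam_bij (I J : choiceType) (h : J -> I) (U S T R : I -> int) :
  bijective h ->
  fam U S T R = fam (U \o h) (S \o h) (T \o h) (R \o h).
Proof. by move=> hb; rewrite /fam (ser_bij _ _ hb). Qed.

Lemma pfam_inj (I J : choiceType) (h : J -> I) (S T R : I -> int) :
  injective h -> pfam S T R -> pfam (S \o h) (T \o h) (R \o h).
Proof. by move=> hi; apply: proper_inj. Qed.

Lemma fam_slices (F : finType) (I : choiceType) (U S T R : F * I -> int) :
  pfam S T R ->
  fam U S T R = \sum_(f : F) fam (fun i => U (f, i)) (fun i => S (f, i))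
                  (fun i => T (f, i)) (fun i => R (f, i)).
Proof. by move=> p; rewrite /fam ser_slices. Qed.

Lemma fam_mono (I : choiceType) (U S T R : I -> int) (u s t r : int) (e : nat) :
  pfam S T R -> e%:Z = x%:Z * s + y%:Z * t + m%:Z * r ->
  mono ((-1) ^ u * a ^ s * b ^ t) e * fam U S T R =
  fam (fun i => u + U i) (fun i => s + S i) (fun i => t + T i) (fun i => r + R i).
Proof.
move=> p E; rewrite /fam ser_mono //; apply: eq_ser => i; last by rewrite E; ring.
by rewrite !expfzDr ?oppr_eq0 ?oner_eq0 //; ring.
Qed.

Lemma famN (I : choiceType) (U S T R : I -> int) :
  pfam S T R -> - fam U S T R = fam (fun i => 1 + U i) S T R.
Proof.
move=> p; rewrite /fam serN //; apply: eq_ser => i //.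
by rewrite expfzDr ?oppr_eq0 ?oner_eq0 // expr1z; ring.
Qed.

End MonomialFamilies.
Arguments fam : simpl never.

Lemma fam_first (K : fieldType) (a b : K) x y m (I : choiceType) (U S R : I -> int) :
  fam a b x y m U S (fun _ => 0) R = fam a 1 x 0 m U S (fun _ => 0) R.
Proof. by apply: eq_ser => i; rewrite ?mulr0 ?expr0z. Qed.

Lemma fam_second (K : fieldType) (a b : K) x y m (I : choiceType) (U S R : I -> int) :
  fam a b x y m U (fun _ => 0) S R = fam b 1 y 0 m U S (fun _ => 0) R.
Proof. by apply: eq_ser => i; rewrite ?mulr0 ?expr0z ?addr0 ?add0r ?mulr1. Qed.

Lemma sum_option_bool (V : nmodType) (F : option bool -> V) :
  \sum_o F o = F (Some false) + F (Some true) + F None.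
Proof.
rewrite (bigD1 (Some false)) //= (bigD1 (Some true)) //= (bigD1 None) //=.
rewrite big_pred0 ?addr0 ?addrA // => -[[]|] //.
Qed.

Section ThetaFunctions.
Variables (x m : nat).
Hypotheses (m0 : (0 < m)%N) (xm : (2 * x <= m)%N).

Let z : int -> int := fun _ => 0.
Definition pen (j : int) : int := 3 * tri j + 2 * j.

Let pf (I : choiceType) := @pfam x 0 m I.

Lemma proper_jac : pf id z tri.
Proof.
have xm' : (x <= m)%N by lia.
have := proper_jexp m0 xm'; rewrite /pf /pfam.
by congr proper; apply: boolp.funext => i; rewrite /jexp /z; ring.
Qed.

Let dominated (E L : int -> int) (C : nat) :
  (forall n, L n <= E n) -> (forall n, 0 <= L n) -> (forall n, `|n| <= L n + C%:Z) ->
  proper E.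
Proof.
move=> LE L0 LC; apply: properW => [n|]; first exact: le_trans (LE n).
by exists C => n; apply: le_trans (LC n) _; rewrite lerD2r.
Qed.

Let mge (n : int) : 0 <= n -> n <= m%:Z * n.
Proof. by move=> n0; nia. Qed.

Let xge (n : int) : 0 <= n -> 0 <= x%:Z * n.
Proof. by move=> n0; nia. Qed.

Let mxge (n : int) : 0 <= n -> 2 * (x%:Z * n) <= m%:Z * n.
Proof. by move=> n0; have : 0 <= (m%:Z - 2 * x%:Z) * n by [apply: mulr_ge0; lia]; lia. Qed.

(** For s < 0, [2 * x <= m] allows 2xs to be replaced by ms, which leaves m (s^2 + s); for s >= 0
    the x-term is dropped. The bounds for [psi], [beta1] and [beta2] follow the same pattern. *)
Lemma proper_phi : pf (fun s => 2 * s) z (fun s => s * s).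
Proof.
apply: (@dominated _ (fun n => if 0 <= n then n * n else n * n + n) 1) => n.
- rewrite /z mulr0 addr0; case: (leP 0 n) => n0.
    by have := @mge (n * n) ltac:(nia); have := xge n0; lia.
  have := @mge (n * n + n) ltac:(nia); have := @mxge (- n) ltac:(lia); lia.
- by case: (leP 0 n) => n0; nia.
- by case: (leP 0 n) => n0; nia.
Qed.

Lemma proper_psi : pf (fun s => 2 * s) z (fun s => s * s - s).
Proof.
apply: (@dominated _ (fun n => if 0 <= n then n * n - n else n * n) 1) => n.
- rewrite /z mulr0 addr0; case: (leP 0 n) => n0.
    by have := @mge (n * n - n) ltac:(nia); have := xge n0; lia.
  have := @mge (n * n) ltac:(nia); have := @mxge (- n) ltac:(lia); lia.
- by case: (leP 0 n) => n0; nia.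
- by case: (leP 0 n) => n0; nia.
Qed.

Lemma proper_alpha : pf (fun i => 3 * i) z (fun i => 3 * tri i).
Proof.
have xm' : (x <= m)%N by lia.
apply: (@dominated _ (jexp x m) 1) => n; last exact: jexp_ge.
  have := jexp_ge0 m0 xm' n; rewrite /jexp /z; lia.
exact: jexp_ge0.
Qed.

Lemma pen2 j : 2 * pen j = 3 * (j * j) + j.
Proof. rewrite /pen; have := tri2 j; lia. Qed.

Lemma proper_beta1 : pf (fun j => - (3 * j)) z pen.
Proof.
apply: (@dominated _ (fun n => if 0 < n then n - 1 else pen n) 1) => n.
- rewrite /z mulr0 addr0; have pn := pen2 n; case: (ltP 0 n) => n0.
    have mp : 2 * (m%:Z * pen n) = m%:Z * (3 * (n * n) + n) by rewrite -pn mulrCA.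
    have := @mxge (3 * n) ltac:(lia).
    have := @mge (3 * (n * n) - 2 * n) ltac:(nia).
    have : 2 * (n - 1) <= 3 * (n * n) - 2 * n by nia.
    by lia.
  by have := @mge (pen n) ltac:(nia); have := @xge (- n) ltac:(lia); lia.
- by case: (ltP 0 n) => n0; have := pen2 n; nia.
- by case: (ltP 0 n) => n0; have := pen2 n; nia.
Qed.

Lemma proper_beta2 : pf (fun j => 3 * j + 1) z pen.
Proof.
apply: (@dominated _ (fun n => if n < 0 then - n - 1 else pen n) 1) => n.
- rewrite /z mulr0 addr0; have pn := pen2 n; case: (ltP n 0) => n0.
    have mp : 2 * (m%:Z * pen n) = m%:Z * (3 * (n * n) + n) by rewrite -pn mulrCA.
    have := @mxge (- (3 * n + 1)) ltac:(lia).
    have := @mge (3 * (n * n) + 4 * n + 1) ltac:(nia).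
    have : 2 * (- n - 1) <= 3 * (n * n) + 4 * n + 1 by nia.
    by lia.
  by have := @mge (pen n) ltac:(nia); have := @xge (3 * n + 1) ltac:(lia); lia.
- by case: (ltP n 0) => n0; have := pen2 n; nia.
- by case: (ltP n 0) => n0; have := pen2 n; nia.
Qed.

Lemma proper_theta3 k : -3 <= k -> k <= 3 -> pf z z (fun s => 3 * (s * s) + k * s).
Proof.
move=> k1 k2.
have E n : 0 <= 3 * (n * n) + k * n.
  have : 0 <= 3 * (n * n) - 3 * n by nia.
  have : 0 <= 3 * (n * n) + 3 * n by nia.
  nia.
apply: (@dominated _ (fun n => 3 * (n * n) + k * n) 1) => n //.
  by rewrite /z !mulr0 !add0r; exact: mge.
have := E n; nia.
Qed.

Variables (K : fieldType) (c : K).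
Hypothesis (c0 : c != 0).

(* The theta series in A = c q^x, p = q^m, with pen j = j(3j+1)/2; beta is the
   series of the quintuple product. *)
Definition phi := fam c 1 x 0 m z (fun s => 2 * s) z (fun s => s * s).
Definition psi := fam c 1 x 0 m z (fun s => 2 * s) z (fun s => s * s - s).
Definition alpha := fam c 1 x 0 m id (fun i => 3 * i) z (fun i => 3 * tri i).
Definition beta1 := fam c 1 x 0 m id (fun j => - (3 * j)) z pen.
Definition beta2 := fam c 1 x 0 m id (fun j => 3 * j + 1) z pen.
Definition beta := beta1 - beta2.
Definition theta3 (k : int) := fam c 1 x 0 m z z z (fun s => 3 * (s * s) + k * s).

Lemma jacE : jac x m c = fam c 1 x 0 m id id z tri.
Proof. by apply: eq_ser => i; rewrite /jexp /z ?expr0z; ring. Qed.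

(* The fibres of (n, s) |-> n + 2 s mod 3, each translated in s so that the
   quadratic form becomes diagonal. *)
Let kappa1 (p : option bool * (int * int)) : int * int :=
  let: (o, (j, s)) := p in
  match o with
  | Some false => (- j - 2 * s, s - j)
  | Some true => (j + 1 + 2 * s, j - s)
  | None => (j - 1 - 2 * s, s + j)
  end.

Let kappa1_bij : bijective kappa1.
Proof.
pose g (p : int * int) : option bool * (int * int) :=
  let k := p.1 + 2 * p.2 in
  let d := (k %/ 3)%Z in
  if (k %% 3 == 0)%Z then (Some false, (- d, p.2 - d))
  else if (k %% 3 == 1)%Z then (Some true, (d, d - p.2))
  else (None, (d + 1, p.2 - d - 1)).
exists g => [[o [j s]]|[n s]]; rewrite /g /=.
  case: o => [[]|] /=; do ?case: eqP => ?; try (exfalso; lia);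
    congr (_, (_, _)); lia.
by do 2?case: eqP => ?; congr (_, _); lia.
Qed.

Let one0 : 1 != 0 :> K. Proof. by rewrite oner_eq0. Qed.

(** The three classes of [kappa1] yield [beta1], [beta2] and [alpha], each times a series in p
    alone. That A does not enter these coefficients makes the determinant argument for [winquist]
    possible. *)
Lemma jac_phi : jac x m c * phi =
  theta3 1 * beta - mono c^-1 (m - x) * (theta3 3 * alpha).
Proof.
rewrite jacE /phi (fam_mul _ _ _ _ proper_jac proper_phi) //.
rewrite (fam_bij _ _ _ _ _ _ _ _ _ kappa1_bij) fam_slices; last first.
  exact: pfam_inj (bij_inj kappa1_bij) (pfam_mul proper_jac proper_phi).
have -> : theta3 1 * beta - mono c^-1 (m - x) * (theta3 3 * alpha) =
    beta1 * theta3 1 - beta2 * theta3 1 + mono (- c^-1) (m - x) * (alpha * theta3 3).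
  by rewrite monoN /beta; ring.
rewrite sum_option_bool.
have p1 : pf z z (fun s => 3 * (s * s) + 1 * s) by exact: proper_theta3.
have p3 : pf z z (fun s => 3 * (s * s) + 3 * s) by exact: proper_theta3.
congr (_ + _ + _).
- rewrite (fam_mul _ _ _ _ proper_beta1 p1) //.
  apply: fam_eq => -[j s] //=; rewrite /z; try lia.
  by have := tri2 (- j - 2 * s); have := pen2 j; lia.
- rewrite (fam_mul _ _ _ _ proper_beta2 p1) // famN; last exact: (pfam_mul proper_beta2 p1).
  apply: fam_eq => -[j s] //=; rewrite /z; try lia.
  by have := tri2 (j + 1 + 2 * s); have := pen2 j; lia.
- rewrite (fam_mul _ _ _ _ proper_alpha p3) //.
  rewrite (_ : - c^-1 = (-1) ^ 1 * c ^ (-1) * 1 ^ 0); last first.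
    by rewrite expr1z expr0z mulr1 mulN1r -exprN1.
  rewrite (@fam_mono _ _ _ _ _ _ _ _ _ _ _ _ _ _ _ _ 1) //; last by lia.
    apply: fam_eq => -[j s] //=; rewrite /z; try lia.
    by have := tri2 (j - 1 - 2 * s); have := tri2 j; lia.
  exact: (pfam_mul proper_alpha p3).
Qed.

(** The same fibres modulo 3 as for [kappa1], with translations adapted to the exponent s^2 - s of
    [psi]. *)
Let kappa2 (p : option bool * (int * int)) : int * int :=
  let: (o, (j, s)) := p in
  match o with
  | Some false => (1 - j + 2 * s, - s - j)
  | Some true => (j - 2 * s, s + 1 + j)
  | None => (j - 2 * s, s + j)
  end.

Let kappa2_bij : bijective kappa2.
Proof.
pose g (p : int * int) : option bool * (int * int) :=
  let k := p.1 + 2 * p.2 in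
  let d := (k %/ 3)%Z in
  if (k %% 3 == 0)%Z then (None, (d, p.2 - d))
  else if (k %% 3 == 1)%Z then (Some false, (- d, d - p.2))
  else (Some true, (d, p.2 - 1 - d)).
exists g => [[o [j s]]|[n s]]; rewrite /g /=.
  case: o => [[]|] /=; do ?case: eqP => ?; try (exfalso; lia);
    congr (_, (_, _)); lia.
by do 2?case: eqP => ?; congr (_, _); lia.
Qed.

Lemma jac_psi : jac x m c * psi =
  theta3 0 * alpha - mono c x * (theta3 2 * beta).
Proof.
rewrite jacE /psi (fam_mul _ _ _ _ proper_jac proper_psi) //.
rewrite (fam_bij _ _ _ _ _ _ _ _ _ kappa2_bij) fam_slices; last first.
  exact: pfam_inj (bij_inj kappa2_bij) (pfam_mul proper_jac proper_psi).
have -> : theta3 0 * alpha - mono c x * (theta3 2 * beta) =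
    mono (- c) x * (beta1 * theta3 2) + mono c x * (beta2 * theta3 2)
    + alpha * theta3 0 by rewrite monoN /beta; ring.
rewrite sum_option_bool.
have p0 : pf z z (fun s => 3 * (s * s) + 0 * s) by exact: proper_theta3.
have p2 : pf z z (fun s => 3 * (s * s) + 2 * s) by exact: proper_theta3.
congr (_ + _ + _).
- rewrite (fam_mul _ _ _ _ proper_beta1 p2) //.
  rewrite (_ : - c = (-1) ^ 1 * c ^ 1 * 1 ^ 0); last first.
    by rewrite !expr1z expr0z mulr1 mulN1r.
  rewrite (@fam_mono _ _ _ _ _ _ _ _ _ _ _ _ _ _ _ _ 0) //; last by lia.
    apply: fam_eq => -[j s] //=; rewrite /z; try lia.
    by have := tri2 (1 - j + 2 * s); have := pen2 j; lia.
  exact: (pfam_mul proper_beta1 p2).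
- rewrite (fam_mul _ _ _ _ proper_beta2 p2) //.
  rewrite (_ : mono c x = mono ((-1) ^ 0 * c ^ 1 * 1 ^ 0) x); last first.
    by rewrite !expr1z !expr0z mulr1 mul1r.
  rewrite (@fam_mono _ _ _ _ _ _ _ _ _ _ _ _ _ _ _ _ 0) //; last by lia.
    apply: fam_eq => -[j s] //=; rewrite /z; try lia.
    by have := tri2 (j - 2 * s); have := pen2 j; lia.
  exact: (pfam_mul proper_beta2 p2).
- rewrite (fam_mul _ _ _ _ proper_alpha p0) //.
  apply: fam_eq => -[j s] //=; rewrite /z; try lia.
  by have := tri2 (j - 2 * s); have := tri2 j; lia.
Qed.

End ThetaFunctions.

(** * Winquist's identity *)

Section ThetaProduct.
Variables (K : fieldType) (m : nat) (a b : K) (x y : nat).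
Hypotheses (m0 : (0 < m)%N) (a0 : a != 0) (b0 : b != 0) (yx : (y <= x)%N) (xm : (2 * x <= m)%N).

Let z : int -> int := fun _ => 0.

(** Pairs of indices sorted by the parity of their sum, in half-sum and half-difference coordinates:
    the half-sum governs the powers of a and the half-difference those of b, so each class factors
    into two single series. *)
Let lambda (p : bool * (int * int)) : int * int :=
  let: (o, (s, d)) := p in
  if o then (s + d, s - d + 1) else (s + d, s - d).

Let lambda_bij : bijective lambda.
Proof.
pose g (p : int * int) : bool * (int * int) :=
  let k := p.1 + p.2 in
  if (k %% 2 == 0)%Z then (false, ((k %/ 2)%Z, p.1 - (k %/ 2)%Z))
  else (true, ((k %/ 2)%Z, p.1 - (k %/ 2)%Z)).
exists g => [[o [s d]]|[n n']]; rewrite /g /=.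
  case: o => /=; case: eqP => ?; try (exfalso; lia); congr (_, (_, _)); lia.
by case: eqP => ?; congr (_, _); lia.
Qed.

Lemma jac_jac :
  jac (x + y) m (a * b) * jac (x - y) m (a / b) =
  psi x m a * phi y m b - mono (a / b) (x - y) * (phi x m a * psi y m b).
Proof.
have ym : (2 * y <= m)%N by lia.
have e1 : jac (x + y) m (a * b) = fam a b x y m id id id tri.
  by apply: eq_ser => i; rewrite ?expfzMl /jexp ?PoszD; ring.
have e2 : jac (x - y) m (a / b) = fam a b x y m id id (fun i => - i) tri.
  apply: eq_ser => i; rewrite ?expfzMl ?exprz_inv ?mulrA // /jexp.
  by rewrite -subzn //; ring.
have p1 : pfam x y m id id tri.
  have := @proper_jexp (x + y) m m0 ltac:(lia); rewrite /pfam.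
  by congr proper; apply: boolp.funext => i; rewrite /jexp PoszD; ring.
have p2 : pfam x y m id (fun i => - i) tri.
  have := @proper_jexp (x - y) m m0 ltac:(lia); rewrite /pfam.
  by congr proper; apply: boolp.funext => i; rewrite /jexp -subzn //; ring.
rewrite e1 e2 (fam_mul _ _ _ _ p1 p2) //.
rewrite (fam_bij _ _ _ _ _ _ _ _ _ lambda_bij) fam_slices; last first.
  exact: pfam_inj (bij_inj lambda_bij) (pfam_mul p1 p2).
have q1 : pfam x y m (fun s => 2 * s) z (fun s => s * s).
  have := @proper_phi x m m0 xm; rewrite /pfam.
  by congr proper; apply: boolp.funext => i; rewrite /z; ring.
have q2 : pfam x y m (fun s => 2 * s) z (fun s => s * s - s).
  have := @proper_psi x m m0 xm; rewrite /pfam.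
  by congr proper; apply: boolp.funext => i; rewrite /z; ring.
have q3 : pfam x y m z (fun s => 2 * s) (fun s => s * s).
  have := @proper_phi y m m0 ym; rewrite /pfam.
  by congr proper; apply: boolp.funext => i; rewrite /z; ring.
have q4 : pfam x y m z (fun s => 2 * s) (fun s => s * s - s).
  have := @proper_psi y m m0 ym; rewrite /pfam.
  by congr proper; apply: boolp.funext => i; rewrite /z; ring.
have -> : phi x m a = fam a b x y m z (fun s => 2 * s) z (fun s => s * s) by rewrite fam_first.
have -> : psi x m a = fam a b x y m z (fun s => 2 * s) z (fun s => s * s - s) by rewrite fam_first.
have -> : phi y m b = fam a b x y m z z (fun s => 2 * s) (fun s => s * s) by rewrite fam_second.
have -> : psi y m b = fam a b x y m z z (fun s => 2 * s) (fun s => s * s - s) by rewrite fam_second.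
rewrite (fam_mul _ _ _ _ q2 q3) // (fam_mul _ _ _ _ q1 q4) //.
have -> u v : u - mono (a / b) (x - y) * v = v * mono ((-1) ^ 1 * a ^ 1 * b ^ (-1)) (x - y) + u.
  by rewrite !expr1z exprN1 mulN1r mulNr monoN; ring.
rewrite [X in _ = X + _]mulrC (@fam_mono _ _ _ _ _ _ a0 b0 _ _ _ _ _ 1 1 (-1) 0); first last.
- by lia.
- exact: pfam_mul q1 q4.
rewrite big_bool; congr (_ + _); apply: fam_eq => -[s d] //=; rewrite /z; try lia.
- by have := tri2 (s + d); have := tri2 (s - d + 1); lia.
- by have := tri2 (s + d); have := tri2 (s - d); lia.
Qed.

End ThetaProduct.

Section Winquist.
Variables (K : fieldType) (m : nat).
Hypothesis m0 : (0 < m)%N.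

Lemma theta3E (c : K) x k :
  theta3 x m c k = ser (fun _ : int => 1 : K) (fun s => m%:Z * (3 * (s * s) + k * s)).
Proof. by apply: eq_ser => i; rewrite ?expr0z ?mulr1 // !mulr0 !add0r. Qed.

Lemma theta3_sym (k : int) :
  ser (fun _ : int => 1 : K) (fun s => m%:Z * (3 * (s * s) - k * s)) =
  ser (fun _ : int => 1 : K) (fun s => m%:Z * (3 * (s * s) + k * s)).
Proof.
rewrite (@ser_bij _ _ _ -%R); last by exists -%R; apply: opprK.
by apply: eq_ser => i //=; ring.
Qed.

(** At x = m and modulus 3m the three factors of the triple product are the three residue classes of
    the factors of (q^m; q^m)_oo. *)
Lemma jac_third : jac m (3 * m) 1 = qp 1 m m :> ps K.
Proof.
rewrite -jacobi_triple_product ?oner_eq0 //; [|lia..].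
rewrite (@qp_split _ 3 1 m m) // !big_ord_recl big_ord0 mulr1 invr1 /= mulrA.
by congr (qp _ _ _ * qp _ _ _ * qp _ _ _); rewrite /bump /=; lia.
Qed.

(** This is [jac_jac] at modulus 3m with a = b = 1 and exponents m and 0: both theta functions on
    its left become [jac_third], and [phi] and [psi] become the four [theta3], two of them after s
    -> -s. *)
Lemma theta3_det (c d : K) x y :
  theta3 x m c 0 * theta3 y m d 1 - mono 1 m * (theta3 x m c 3 * theta3 y m d 2)
  = qp 1 m m ^+ 2.
Proof.
have m30 : (0 < 3 * m)%N by lia.
have one0 : 1 != 0 :> K by rewrite oner_eq0.
have := @jac_jac K (3 * m) 1 1 m 0 m30 one0 one0 (leq0n m) ltac:(lia).
rewrite addn0 subn0 divr1 mulr1 jac_third -expr2 => ->.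
have -> : phi 0 (3 * m) (1 : K) = theta3 x m c 0.
  by rewrite theta3E; apply: eq_ser => i; rewrite ?exp1rz ?expr0z ?mulr1 // PoszM; ring.
have -> : psi m (3 * m) (1 : K) = theta3 y m d 1.
  rewrite theta3E -theta3_sym; apply: eq_ser => i; rewrite ?exp1rz ?expr0z ?mulr1 // PoszM; ring.
have -> : phi m (3 * m) (1 : K) = theta3 y m d 2.
  by rewrite theta3E; apply: eq_ser => i; rewrite ?exp1rz ?expr0z ?mulr1 // PoszM; ring.
have -> : psi 0 (3 * m) (1 : K) = theta3 x m c 3.
  rewrite theta3E -theta3_sym; apply: eq_ser => i; rewrite ?exp1rz ?expr0z ?mulr1 // PoszM; ring.
by ring.
Qed.

(* One side of Winquist's identity, for A = a q^x, B = b q^y and p = q^m: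
   alpha(A) beta(B) - (A/B) alpha(B) beta(A). *)
Definition winq (a b : K) (x y : nat) : ps K :=
  alpha x m a * beta y m b - mono (a / b) (x - y) * (alpha y m b * beta x m a).

(** By [jac_jac] the left side is a 2x2 determinant formed from [jac * phi] and [jac * psi] at a and
    at b. [jac_phi] and [jac_psi] apply one linear map to the vectors (alpha, beta) at a and at b,
    up to monomials, so the determinant factors and [theta3_det] evaluates that of the map. *)
Theorem winquist (a b : K) (x y : nat) :
  a != 0 -> b != 0 -> (y <= x)%N -> (2 * x <= m)%N ->
  jac x m a * jac y m b * jac (x + y) m (a * b) * jac (x - y) m (a / b) =
  qp 1 m m ^+ 2 * winq a b x y.
Proof.
move=> a0 b0 yx xm; have ym : (2 * y <= m)%N by lia.
rewrite -mulrA jac_jac //.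
have t0 : theta3 x m a 0 = theta3 y m b 0 by rewrite !theta3E.
have t1 : theta3 x m a 1 = theta3 y m b 1 by rewrite !theta3E.
have t2 : theta3 x m a 2 = theta3 y m b 2 by rewrite !theta3E.
have t3 : theta3 x m a 3 = theta3 y m b 3 by rewrite !theta3E.
have := jac_phi m0 xm a0; have := jac_phi m0 ym b0.
have := jac_psi m0 xm a0; have := jac_psi m0 ym b0.
rewrite -(theta3_det b b y y) /winq t0 t1 t2 t3.
(* All monomials are expressed through the three that become M, w and t, so that the rest is an
   identity in independent variables. *)
have <- : mono (a / b) (x - y) * mono a^-1 (m - x) = mono b^-1 (m - y).
  by rewrite monoM mulrAC divff // mul1r; congr mono; lia.
have <- : mono (a / b) (x - y) * mono b y = mono a x.
  by rewrite monoM divfK //; congr mono; lia.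
have -> : mono 1 m = mono (a / b) (x - y) * mono a^-1 (m - x) * mono b y.
  by rewrite !monoM mulrAC divfK // divff //; congr mono; lia.
move: (mono (a / b) _) (mono a^-1 _) (mono b _) => M w t.
move: (theta3 _ _ _ 0) (theta3 _ _ _ 1) (theta3 _ _ _ 2) (theta3 _ _ _ 3) => h f e g.
move: (jac x m a) (jac y m b) => A B.
move: (phi x m a) (phi y m b) (psi x m a) (psi y m b) => phi_a phi_b psi_a psi_b.
move: (alpha x m a) (alpha y m b) (beta x m a) (beta y m b) => al_a al_b be_a be_b.
move=> E1 E2 E3 E4.
transitivity ((A * psi_a) * (B * phi_b) - M * ((A * phi_a) * (B * psi_b))); first by ring.
by rewrite E1 E2 E3 E4; ring.
Qed.

End Winquist.

(** * Eleven-dissection of the theta series *)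

Ltac tri_lia :=
  repeat match goal with |- context [tri ?n] => move: (tri2 n); move: (tri n) => ? end;
  lia.

Section Dissection.
Variables (K : fieldType) (w : K).
Hypotheses (two0 : 2 != 0 :> K) (w11 : w ^+ 11 = 1).

Let z : int -> int := fun _ => 0.

Let w0 : w != 0.
Proof.
by apply/eqP => w0; move/eqP: w11; rewrite w0 expr0n eq_sym oner_eq0.
Qed.

(** The index r stands for the residue r - 4. The symmetry n -> 1 - n of [tri] exchanges i and 9 -
    i, and fixes 10, the residue 6. *)
Lemma sum_residues (V : comNzRingType) (F : nat -> V) :
  \sum_(r < 11) F r = \sum_(i < 5) (F i + F (9 - i)%N) + F 10%N.
Proof. by rewrite !big_ord_recr !big_ord0 /= /subn /=; ring. Qed.

(** Here r stands for r - 7. Since -1/3 = -4 modulo 11, the symmetry of [pen] is j -> -4 - j; it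
    exchanges 4 - i and 6 + i, and fixes 5, the residue -2. *)
Lemma sum_residues_beta (V : comNzRingType) (F : nat -> V) :
  \sum_(r < 11) F r = \sum_(i < 5) (F (4 - i)%N + F (6 + i)%N) + F 5%N.
Proof. by rewrite !big_ord_recr !big_ord0 /= /subn /=; ring. Qed.

Lemma fam_residues (U S R : int -> int) (o : int) : pfam 0 0 1 S z R ->
  fam w 1 0 0 1 U S z R =
  \sum_(r < 11) fam w 1 0 0 1 (fun t => U (11 * t + (r%:Z - o)))
    (fun t => S (11 * t + (r%:Z - o))) z (fun t => R (11 * t + (r%:Z - o))).
Proof.
move=> p; pose h (p : 'I_11 * int) : int := 11 * p.2 + (p.1%:Z - o).
have hb : bijective h.
  exists (fun n => (inord (absz ((n + o) %% 11)%Z), ((n + o) %/ 11)%Z)).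
    move=> [r t]; rewrite /h /=; have r11 := ltn_ord r; congr (_, _); last by lia.
    by apply: val_inj; rewrite /= inordK; lia.
  by move=> n; rewrite /h /= inordK; lia.
by rewrite (fam_bij _ _ _ _ _ _ _ _ _ hb) fam_slices //; exact: pfam_inj (bij_inj hb) p.
Qed.

Lemma wX (s s' : int) : (11 %| s - s')%Z -> w ^ s = w ^ s'.
Proof.
move=> /dvdzP [k E]; have -> : s = 11 * k + s' by lia.
by rewrite expfzDr // -exprz_exp -exprnP w11 exp1rz mul1r.
Qed.

Lemma sign_parity (k l : int) : (2 %| k - l)%Z -> (-1) ^ k = (-1) ^ l :> K.
Proof.
move=> /dvdzP [j E]; have -> : k = 2 * j + l by lia.
rewrite expfzDr ?oppr_eq0 ?oner_eq0 // -[in LHS]exprz_exp.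
by rewrite (_ : (-1) ^ 2 = 1 :> K) ?exp1rz ?mul1r // -exprnP sqrrN expr1n.
Qed.

(** Identifies one residue class modulo 11 with a monomial times a series at modulus 121. The sign g
    reverses the running index, as one of two mirror residues requires. *)
Lemma slice_match (U S R U' S' R' : int -> int) (x : nat) (u g : int) (s e : nat) :
  g * g = 1 ->
  pfam x 0 121 S' z R' ->
  (forall t, (2 %| U (g * t) - (u + U' t))%Z) ->
  (forall t, (11 %| S (g * t) - s%:Z)%Z) ->
  (forall t, R (g * t) = e%:Z + x%:Z * S' t + 121 * R' t) ->
  fam w 1 0 0 1 U S z R =
  mono ((-1) ^ u * w ^+ s) e * fam 1 1 x 0 121 U' S' z R'.
Proof.
move=> gg p HU HS HR; have gb : bijective ( *%R g).
  by exists ( *%R g) => t; rewrite mulrA gg mul1r.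
rewrite (fam_bij _ _ _ _ _ _ _ _ _ gb).
rewrite /fam ser_mono //; apply: eq_ser => t /=; last by rewrite HR /z; ring.
rewrite !exp1rz !mulr1 (wX (HS t)) -exprnP mulrAC; congr (_ * _).
by rewrite -expfzDr ?oppr_eq0 ?oner_eq0 //; apply: sign_parity.
Qed.

(* al_exp x = 3(x-5)(x-6)/2 and be_exp y = (3y-5)(y-2)/2 for 1 <= x, y <= 5. *)
Definition al_exp (x : nat) : nat := nth 0%N [:: 0; 30; 18; 9; 3; 0]%N x.
Definition be_exp (y : nat) : nat := nth 0%N [:: 0; 1; 0; 2; 7; 15]%N y.

Lemma alpha_dissect : alpha 0 1 w =
  \sum_(i < 5) mono ((-1) ^+ i * (w ^+ (3 * i + 10) - w ^+ (15 - 3 * i))) (al_exp i.+1)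
    * alpha (11 * i.+1) 121 1.
Proof.
have p : pfam 0 0 1 (fun i => 3 * i) z (fun i => 3 * tri i) by exact: proper_alpha.
rewrite {1}/alpha (fam_residues _ 4 p).
pose F r := fam w 1 0 0 1 (fun t => 11 * t + (r%:Z - 4)) (fun t => 3 * (11 * t + (r%:Z - 4))) z (fun t => 3 * tri (11 * t + (r%:Z - 4))).
rewrite (eq_bigr (fun r : 'I_11 => F r)) //.
have pA (i : nat) : (i < 5)%N -> pfam (11 * i.+1) 0 121 (fun i => 3 * i) z (fun i => 3 * tri i).
  by move=> i5; apply: proper_alpha => //; lia.
(* The residue i - 4 gives w^(3 (i - 4)) = w^(3 i + 10); its mirror image 5 - i gives w^(15 - 3 i)
   with the opposite sign. *)
have F1 (i : nat) : (i < 5)%N -> F i = mono ((-1) ^ (i%:Z) * w ^+ (3 * i + 10)) (al_exp i.+1) * alpha (11 * i.+1) 121 1.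
  move=> i5; apply: (@slice_match _ _ _ _ _ _ _ _ 1) => // [||t|t]; [exact: pA|lia|lia|].
  by case: i i5 => [|[|[|[|[|]]]]] // _; rewrite /F /al_exp /nth; tri_lia.
have F2 (i : nat) : (i < 5)%N -> F (9 - i)%N = mono ((-1) ^ (i%:Z + 1) * w ^+ (15 - 3 * i)) (al_exp i.+1) * alpha (11 * i.+1) 121 1.
  move=> i5; apply: (@slice_match _ _ _ _ _ _ _ _ (-1)) => // [||t|t]; [exact: pA|lia|lia|].
  by case: i i5 => [|[|[|[|[|]]]]] // _; rewrite /F /al_exp /nth; tri_lia.
(* The residue 6 is mapped to itself by n -> 1 - n, which flips the sign (-1)^n; the slice equals
   its own negative. *)
have F3 : F 10%N = 0.
  have p10 : pfam 0 0 1 (fun t => 3 * (11 * t + (10%:Z - 4))) z (fun t => 3 * tri (11 * t + (10%:Z - 4))).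
    by apply: (@pfam_inj _ _ _ _ _ (fun t => 11 * t + (10%:Z - 4)) _ _ _ _ p) => t t'; lia.
  suff E : F 10%N = - F 10%N.
    apply/psP => n; apply: (mulfI two0); rewrite mulr0 mulr_natl mulr2n.
    by rewrite [X in _ + X = _](congr1 (fun f : ps K => f n) E) cfN subrr.
  have hb : bijective (fun t : int => - 1 - t) by exists (fun t => - 1 - t) => t; lia.
  rewrite /F [RHS]famN // [LHS](fam_bij _ _ _ _ _ _ _ _ _ hb).
  apply: eq_ser => t /=; last by rewrite /z; tri_lia.
  congr (_ * _ * _); [apply: sign_parity|apply: wX]; lia.
rewrite sum_residues F3 addr0; apply: eq_bigr => i _.
rewrite F1 ?F2 // -mulrDl -monoD; congr (mono _ _ * _).
rewrite mulrBr -mulNr -exprnP; congr (_ + _ * _).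
by rewrite expfzDr ?oppr_eq0 ?oner_eq0 // expr1z mulrN1.
Qed.

Lemma beta_dissect : beta 0 1 w =
  \sum_(i < 5) mono ((-1) ^+ i * (w ^+ (3 * i + 9) - w ^+ (14 - 3 * i))) (be_exp i.+1)
    * beta (11 * i.+1) 121 1.
Proof.
have p1 : pfam 0 0 1 (fun j => - (3 * j)) z pen by exact: proper_beta1.
have p2 : pfam 0 0 1 (fun j => 3 * j + 1) z pen by exact: proper_beta2.
rewrite {1}/beta {1}/beta1 {1}/beta2 (fam_residues _ 7 p1) (fam_residues _ 7 p2).
pose F r := fam w 1 0 0 1 (fun t => 11 * t + (r%:Z - 7)) (fun t => - (3 * (11 * t + (r%:Z - 7)))) z (fun t => pen (11 * t + (r%:Z - 7))).
pose G r := fam w 1 0 0 1 (fun t => 11 * t + (r%:Z - 7)) (fun t => 3 * (11 * t + (r%:Z - 7)) + 1) z (fun t => pen (11 * t + (r%:Z - 7))).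
rewrite (eq_bigr (fun r : 'I_11 => F r)) // [X in _ - X](eq_bigr (fun r : 'I_11 => G r)) //.
have pB1 (i : nat) : (i < 5)%N -> pfam (11 * i.+1) 0 121 (fun j => - (3 * j)) z pen.
  by move=> i5; apply: proper_beta1 => //; lia.
have pB2 (i : nat) : (i < 5)%N -> pfam (11 * i.+1) 0 121 (fun j => 3 * j + 1) z pen.
  by move=> i5; apply: proper_beta2 => //; lia.
have F1 (i : nat) : (i < 5)%N -> F (4 - i)%N = mono ((-1) ^ (i%:Z + 1) * w ^+ (3 * i + 9)) (be_exp i.+1) * beta2 (11 * i.+1) 121 1.
  move=> i5; apply: (@slice_match _ _ _ _ _ _ _ _ (-1)) => // [||t|t]; [exact: pB2|lia|lia|].
  by case: i i5 => [|[|[|[|[|]]]]] // _; rewrite /F /be_exp /nth /pen; tri_lia.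
have F2 (i : nat) : (i < 5)%N -> F (6 + i)%N = mono ((-1) ^ (i%:Z + 1) * w ^+ (14 - 3 * i)) (be_exp i.+1) * beta1 (11 * i.+1) 121 1.
  move=> i5; apply: (@slice_match _ _ _ _ _ _ _ _ (-1)) => // [||t|t]; [exact: pB1|lia|lia|].
  by case: i i5 => [|[|[|[|[|]]]]] // _; rewrite /F /be_exp /nth /pen; tri_lia.
have G1 (i : nat) : (i < 5)%N -> G (4 - i)%N = mono ((-1) ^ (i%:Z + 1) * w ^+ (14 - 3 * i)) (be_exp i.+1) * beta2 (11 * i.+1) 121 1.
  move=> i5; apply: (@slice_match _ _ _ _ _ _ _ _ (-1)) => // [||t|t]; [exact: pB2|lia|lia|].
  by case: i i5 => [|[|[|[|[|]]]]] // _; rewrite /F /be_exp /nth /pen; tri_lia.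
have G2 (i : nat) : (i < 5)%N -> G (6 + i)%N = mono ((-1) ^ (i%:Z + 1) * w ^+ (3 * i + 9)) (be_exp i.+1) * beta1 (11 * i.+1) 121 1.
  move=> i5; apply: (@slice_match _ _ _ _ _ _ _ _ (-1)) => // [||t|t]; [exact: pB1|lia|lia|].
  by case: i i5 => [|[|[|[|[|]]]]] // _; rewrite /F /be_exp /nth /pen; tri_lia.
(* For j = -2 modulo 11 the exponents -3j and 3j + 1 agree modulo 11, so the fixed slices of [beta1]
   and [beta2] cancel. *)
have FG : F 5%N = G 5%N.
  by apply: eq_ser => t; [congr (_ * _ * _); apply: wX; lia|rewrite !mul0r].
rewrite !sum_residues_beta FG.
rewrite opprD addrACA subrr addr0 -sumrB; apply: eq_bigr => i _.
rewrite F1 // F2 // G1 // G2 // /beta.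
have -> : (-1) ^ (i%:Z + 1) = - (-1) ^+ i :> K.
  by rewrite expfzDr ?oppr_eq0 ?oner_eq0 // expr1z mulrN1 -exprnP.
by rewrite [(-1) ^+ i * (_ - _)]mulrBr !mulNr monoD !monoN; ring.
Qed.

End Dissection.

(* The i-th term of v11 is q^e times the Winquist product of (Q^x; Q^y), Q = q^11,
   and term_c lists the coefficients of its multiplier as a polynomial in z. *)
Definition term_x : seq nat := [:: 5; 5; 5; 4; 4; 4; 5; 2; 3; 3]%N.
Definition term_y : seq nat := [:: 2; 1; 3; 2; 1; 3; 4; 1; 2; 1]%N.
Definition term_e : seq nat := [:: 0; 1; 2; 3; 4; 5; 7; 19; 9; 10]%N.
Definition term_c : seq (seq int) :=
  [:: [:: 1]; [:: -1; 1; 0; 0; 0; 0; 0; 0; 0; 0; 1];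
      [:: 0; 0; 1; 0; 0; 0; 0; 0; 0; 1]; [:: 1; 0; 0; 1; 0; 0; 0; 0; 1];
      [:: 1; 0; 1; 0; 1; 0; 0; 1; 0; 1]; [:: 0; 0; -1; 0; -1; 0; 0; -1; 0; -1];
      [:: 0; 1; 0; 0; 1; 0; 0; 1; 0; 0; 1]; [:: 0; 1; 0; 1; 1; 0; 0; 1; 1; 0; 1];
      [:: -1; 0; 0; 0; -1; 0; 0; -1]; [:: 0; 0; 0; -1; 0; 0; 0; 0; -1]].

Definition term_coef (K : fieldType) (z : K) (i : nat) : K :=
  \sum_(k < 11) ((nth [::] term_c i)`_k)%:~R * z ^+ k.

Definition winq_term (K : fieldType) (i : nat) : ps K :=
  mono 1 (nth 0%N term_e i) *
  winq 121 1 1 (11 * nth 0%N term_x i) (11 * nth 0%N term_y i).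

Lemma mono_int (K : fieldType) (n : int) : mono n%:~R 0 = n%:~R :> ps K.
Proof.
have nat_case k : mono k%:R 0 = k%:R :> ps K.
  by elim: k => [|k IH]; [apply/psP => j /=; case: eqP|rewrite !mulrS monoD IH mono1].
by case: n => n; rewrite ?NegzE ?mulrNz ?monoN -!pmulrn nat_case.
Qed.

(** The prefactor gathers the factors 1 - z^k that [jac 0 1 (z ^+ k)] has at its first exponent, for
    k = 5, 2, 5 + 2 and 5 - 2. With both dissections inserted, the claim is a polynomial identity
    modulo Z^11 = 1 in q and the ten series [A x], [B x]. *)
Lemma winq_dissect (K : fieldType) (z : K) : 2 != 0 :> K -> z ^+ 11 = 1 ->
  winq 1 (z ^+ 5) (z ^+ 2) 0 0 =
  mono ((1 - z ^+ 5) * (1 - z ^+ 2) * (1 - z ^+ 7) * (1 - z ^+ 3)) 0 *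
  \sum_(i < 10) mono (term_coef z i) 0 * winq_term K i.
Proof.
move=> two0 z11.
have z0 : z != 0.
  by apply/eqP => z0; move/eqP: z11; rewrite z0 expr0n eq_sym oner_eq0.
have w11 k : (z ^+ k) ^+ 11 = 1 by rewrite exprAC z11 expr1n.
pose A x := alpha (11 * x) 121 (1 : K); pose B x := beta (11 * x) 121 (1 : K).
have [q Hq] : exists q : ps K, forall c e, mono c e = mono c 0 * q ^+ e.
  by exists (mono 1 1) => c e; rewrite monoX expr1n mul1n monoM mulr1 add0n.
have HG x y : winq 121 1 1 (11 * x) (11 * y) =
    A x * B y - q ^+ (11 * (x - y)) * (A y * B x).
  by rewrite /winq divr1 -mulnBr Hq mono1 mul1r.
pose Z := mono z 0; have Z11 : Z ^+ 11 = 1 by rewrite /Z monoX z11 mul0n mono1.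
have CX n : mono (z ^+ n) 0 = Z ^+ n by rewrite /Z monoX mul0n.
have CM c d : mono (c * d) 0 = mono c 0 * mono d 0 :> ps K by rewrite monoM.
have CS i : mono ((-1) ^+ i) 0 = (-1) ^+ i :> ps K.
  by rewrite -[in RHS](mono1 K) -monoN monoX.
have CB c d : mono (c - d) 0 = mono c 0 - mono d 0 :> ps K by rewrite monoD monoN.
have alE k : alpha 0 1 (z ^+ k) =
    \sum_(i < 5) (-1) ^+ i * (Z ^+ (k * (3 * i + 10) %% 11) - Z ^+ (k * (15 - 3 * i) %% 11))
      * q ^+ al_exp i.+1 * A i.+1.
  rewrite alpha_dissect //; apply: eq_bigr => i _.
  by rewrite Hq CM CS CB -!exprM !CX !expr_mod.
have beE k : beta 0 1 (z ^+ k) =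
    \sum_(i < 5) (-1) ^+ i * (Z ^+ (k * (3 * i + 9) %% 11) - Z ^+ (k * (14 - 3 * i) %% 11))
      * q ^+ be_exp i.+1 * B i.+1.
  rewrite beta_dissect //; apply: eq_bigr => i _.
  by rewrite Hq CM CS CB -!exprM !CX !expr_mod.
have tE i : mono (term_coef z i) 0 * winq_term K i =
    (\sum_(k < 11) ((nth [::] term_c i)`_k)%:~R * Z ^+ k) * q ^+ nth 0%N term_e i *
    (A (nth 0%N term_x i) * B (nth 0%N term_y i)
     - q ^+ (11 * (nth 0%N term_x i - nth 0%N term_y i)) *
       (A (nth 0%N term_y i) * B (nth 0%N term_x i))).
  rewrite /winq_term HG (Hq 1) mono1 mul1r mulrA /term_coef mono_sum.
  congr (_ * _ * _); apply: eq_bigr => k _.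
  rewrite CM CX; congr (_ * _).
  exact: mono_int.
rewrite (eq_bigr _ (fun (i : 'I_10) _ => tE i)).
rewrite {1}/winq !alE !beE (_ : z ^+ 5 / z ^+ 2 = z ^+ 3); last first.
  by rewrite -expfB.
rewrite subn0 CX !CM !CB !CX mono1 {tE alE beE CX CM CS CB HG Hq}.
rewrite !(big_ord_recr, big_ord0) /=.
rewrite /al_exp /be_exp /term_x /term_y /term_e /term_c /=.
rewrite /subn /=.
move: (A 1%N) (A 2%N) (A 3%N) (A 4%N) (A 5%N) (B 1%N) (B 2%N) (B 3%N) (B 4%N) (B 5%N).
move: Z11 => {z0 w11}; move: Z => Z Z11 a1 a2 a3 a4 a5 b1 b2 b3 b4 b5.
repeat match goal with |- context [modn ?k ?l] =>
  let v := eval vm_compute in (modn k l) in change (modn k l) with v end.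
repeat match goal with |- context [muln ?k ?l] =>
  let v := eval vm_compute in (muln k l) in change (muln k l) with v end.
by ring: Z11.
Qed.

(** * Cauchy's q-binomial theorem *)

Section InfiniteSums.
Variable K : fieldType.
Implicit Types (u v : nat -> ps K) (f g : ps K) (N M : nat).

(** Rescaled to constant term 1, f is 1 - h with h(0) = 0, and the geometric series in h inverts it.
    The condition on f sits inside the sigma type so that [psinv] is total. *)
Lemma ps_invertible f : {g | f 0%N != 0 -> f * g = 1}.
Proof.
 pose c := mono (f 0%N)^-1 0; pose h := 1 - c * f.
have h0 : f 0%N != 0 -> eqmod 1 h 0.
  by move=> f0 [] // _; rewrite /h cfB mono_mulE /= mulVf // subrr.
have hX k : f 0%N != 0 -> eqmod k (h ^+ k) 0.
  move=> f0; elim: k => [|k IH] n // nk; rewrite exprS cfM big1 // => i _.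
  have [i0|i0] := posnP i; first by rewrite i0 h0 ?mul0r.
  by rewrite IH ?mulr0 //; have := ltn_ord i; lia.
pose g := PS (fun n => (\sum_(k < n.+1) h ^+ k) n).
have gE N M : f 0%N != 0 -> (N <= M)%N -> eqmod N (\sum_(k < M) h ^+ k) g.
  move=> f0 NM n nN; rewrite /g /=.
  have {NM nN} nM : (n < M)%N by apply: leq_trans NM.
  elim: M nM => // M IH; rewrite ltnS leq_eqVlt => /orP[/eqP -> //|nM].
  by rewrite big_ord_recr /= IH // hX ?addr0.
exists (c * g) => f0; rewrite mulrA [f * c]mulrC.
have -> : c * f = 1 - h by rewrite /h; ring.
apply: eqmodP => N; apply: eqmod_trans (eqmodM (eqmod_refl _) (eqmod_sym (gE N N f0 (leqnn N)))) _.
have -> : (1 - h) * \sum_(k < N) h ^+ k = 1 - h ^+ N.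
  by rewrite -opprB mulNr -subrX1 opprB.
by rewrite -[X in eqmod _ _ X]subr0; apply: eqmodB => //; apply: hX.
Qed.

Definition psinv f : ps K := sval (ps_invertible f).

Lemma psinvP f : f 0%N != 0 -> f * psinv f = 1.
Proof. exact: svalP (ps_invertible f). Qed.

Definition near0 u := forall j, eqmod j (u j) 0.

Definition lsum u : ps K := PS (fun n => (\sum_(j < n.+1) u j) n).

Lemma lsum_approx u N M : near0 u -> (N <= M)%N ->
  eqmod N (\sum_(j < M) u j) (lsum u).
Proof.
move=> Hu NM n nN; rewrite /lsum /=.
have {NM nN} nM : (n < M)%N by apply: leq_trans NM.
elim: M nM => // M IH; rewrite ltnS leq_eqVlt => /orP[/eqP -> //|nM].
by rewrite big_ord_recr /= IH // Hu ?addr0.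
Qed.

Lemma eq_lsum u v : u =1 v -> lsum u = lsum v.
Proof. by move=> uv; apply/psP => n /=; under eq_bigr do rewrite uv. Qed.

Lemma near0Ml f u : near0 u -> near0 (fun j => f * u j).
Proof. by move=> Hu j; rewrite -(mulr0 f); apply: eqmodM. Qed.

Lemma lsumMl f u : near0 u -> f * lsum u = lsum (fun j => f * u j).
Proof.
move=> Hu; apply: eqmodP => N.
apply: eqmod_trans (eqmodM (eqmod_refl f) (eqmod_sym (lsum_approx Hu (leqnn N)))) _.
rewrite mulr_sumr; apply: lsum_approx => //; exact: near0Ml.
Qed.

Lemma lsumD u v : lsum u + lsum v = lsum (fun j => u j + v j).
Proof. by apply/psP => n /=; rewrite big_split. Qed.

Lemma lsumN u : - lsum u = lsum (fun j => - u j).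
Proof. by apply/psP => n /=; rewrite sumrN. Qed.

Lemma lsum_recl u : near0 u -> lsum u = u 0%N + lsum (u \o S).
Proof.
move=> Hu; apply/psP => n; rewrite [LHS]/= big_ord_recl !cfD; congr (_ + _).
by rewrite /lsum [RHS]/= [X in _ = cf X _]big_ord_recr /= Hu ?addr0.
Qed.

(* (cq;q)_oo sum_j (f;q)_j/(q;q)_j (cq)^j = (fcq;q)_oo, where u k is the sum with
   cq replaced by c q^(k+1). *)
Section QBinomial.
Variables (f : ps K) (c : K).

Let D j : ps K := \prod_(i < j) (1 - mono 1 i.+1).
Let N j : ps K := \prod_(i < j) (1 - f * mono 1 i).

Let D0 j : D j 0%N != 0.
Proof.
rewrite /D; suff -> : (\prod_(i < j) (1 - mono 1 i.+1) : ps K) 0%N = 1 by rewrite oner_eq0.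
elim: j => [|j IH]; first by rewrite big_ord0.
by rewrite big_ord_recr cfM big_ord1 IH /= mul1r subr0.
Qed.

Let u k j : ps K := N j * psinv (D j) * mono (c ^+ j) (k.+1 * j).

Let near0u k : near0 (u k).
Proof. by move=> j; rewrite /u mulrC; apply: eqmod_mono0; rewrite leq_pmull. Qed.

Let DS j : psinv (D j) = psinv (D j.+1) * (1 - mono 1 j.+1).
Proof.
apply: (ps_mulI (D0 j.+1)); rewrite mulrA psinvP // mul1r.
by rewrite /D big_ord_recr mulrAC -/(D j) psinvP // mul1r.
Qed.

Lemma q_binomial :
  qp c 1 1 * lsum (fun j => N j * psinv (D j) * mono (c ^+ j) j)
  = iprod (fun k => 1 - f * mono c k.+1).
Proof.
have D00 : psinv (D 0) = 1 by have := psinvP (D0 0); rewrite {1}/D big_ord0 mul1r.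
have u0 k : u k 0 = 1 by rewrite /u D00 /N big_ord0 muln0 expr0 mono1 !mulr1.
have uS k j : u k j.+1 - u k.+1 j.+1 = mono c k.+1 * (u k j - f * u k.+1 j).
  have -> : u k.+1 j.+1 = mono 1 j.+1 * u k j.+1.
    by rewrite /u mulrCA monoM mul1r; congr (_ * mono _ _); lia.
  have -> : u k.+1 j = mono 1 j * u k j.
    by rewrite /u mulrCA monoM mul1r; congr (_ * mono _ _); lia.
  rewrite /u [psinv (D j)]DS /N big_ord_recr /=.
  have -> : mono (c ^+ j.+1) (k.+1 * j.+1) = mono c k.+1 * mono (c ^+ j) (k.+1 * j).
    by rewrite monoM exprS; congr (mono _ _); lia.
  by ring.
have near0S k : near0 (u k \o S) by move=> j n nj; apply: near0u; lia.
(* Summing [uS] over j gives the functional equation under c -> cq. Iterated n times it splits off n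
   factors of each product, and the remaining sum tends to 1. *)
have step k : (1 - mono c k.+1) * lsum (u k) = (1 - f * mono c k.+1) * lsum (u k.+1).
  apply/eqP; rewrite -subr_eq0.
  have -> : (1 - mono c k.+1) * lsum (u k) - (1 - f * mono c k.+1) * lsum (u k.+1)
    = (lsum (u k) - lsum (u k.+1)) - mono c k.+1 * (lsum (u k) - f * lsum (u k.+1)).
    by ring.
  rewrite {1}(lsum_recl (near0u k)) {1}(lsum_recl (near0u k.+1)) !u0.
  rewrite opprD addrACA subrr add0r lsumN lsumD (eq_lsum (uS k)).
  rewrite -lsumMl -?lsumD -?lsumN -?lsumMl ?subrr //; try exact: near0Ml.
  by move=> j; rewrite -[X in eqmod _ _ X]subr0; apply: eqmodB; [apply: near0u|apply: near0Ml].
have iter n : \prod_(i < n) (1 - mono c i.+1) * lsum (u 0%N) =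
    \prod_(i < n) (1 - f * mono c i.+1) * lsum (u n).
  elim: n => [|n IH]; first by rewrite !big_ord0.
  by rewrite !big_ord_recr /= mulrAC IH -[LHS]mulrA [X in _ * X = _]mulrC step mulrA.
have -> : lsum (fun j => N j * psinv (D j) * mono (c ^+ j) j) = lsum (u 0%N).
  by apply: eq_lsum => j; rewrite /u mul1n.
have lim n : eqmod n (lsum (u n)) 1.
  rewrite lsum_recl // u0 -[X in eqmod _ _ X]addr0; apply: eqmodD => // i ni.
  rewrite /lsum /= cf_sum big1 // => j _; rewrite /u mulrC; apply: eqmod_mono0 (leqnn _) _ _.
  by nia.
have n1 : near1 (fun k => 1 - f * mono c k.+1).
  move=> i n ni; rewrite -[RHS]subr0 !cfB; congr (_ - _).
  by rewrite mulrC mono_mulE leqNgt ltnS (ltnW ni).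
apply: eqmodP => n.
have E i : qfac c 1 1 i = 1 - mono c i.+1 by rewrite /qfac mul1n add1n.
apply: (@eqmod_trans _ _ _ (\prod_(i < n) (1 - mono c i.+1) * lsum (u 0%N))).
  apply: eqmodM => //; apply/eqmod_sym; rewrite /qp (eq_iprod E).
  by apply: iprod_approx => // i; rewrite -E; apply: near1_qfac.
rewrite iter -[X in eqmod _ _ X]mulr1; apply: eqmodM; last exact: lim.
exact: iprod_approx.
Qed.
End QBinomial.

End InfiniteSums.

(** * The crank generating function *)

Section CrankProduct.
Variables (K : fieldType) (z : K).
Hypothesis z0 : z != 0.

(** This is (q^2; q)_(j-1), whose reciprocal generates the partitions into parts from 2 to j. *)
Definition qtail j : ps K := \prod_(2 <= s < j.+1) (1 - mono 1 s).

(* The generating functions of the partitions without ones and with largest part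
   L, and of those with exactly j ones, both weighted by z^crank. *)
Definition crank_noones L : ps K :=
  if (L < 2)%N then 0 else mono (z ^+ L) L * psinv (qtail L).
Definition crank_ones j : ps K :=
  if j == 0%N then 0 else mono (z^-1 ^+ j) j * psinv (qtail j * qp z j.+1 1).

Lemma prod_cf0 (r : seq nat) (F : nat -> ps K) :
  (forall i, i \in r -> F i 0%N = 1) -> (\prod_(i <- r) F i) 0%N = 1.
Proof.
elim: r => [|i r IH] H; first by rewrite big_nil.
rewrite big_cons cfM big_ord1 /= subnn H ?mem_head // mul1r IH // => j jr.
by apply: H; rewrite inE jr orbT.
Qed.

Lemma qtail_cf0 j : qtail j 0%N = 1.
Proof.
apply: prod_cf0 => i; rewrite mem_index_iota => /andP[i2 _] /=.
by rewrite eq_sym (gtn_eqF (ltnW i2)) subr0.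
Qed.

Lemma qtailE j : (0 < j)%N ->
  (1 - mono 1 1) * qtail j = \prod_(i < j) (1 - mono 1 i.+1).
Proof.
case: j => // j _; rewrite big_ord_recl; congr (_ * _).
rewrite /qtail -(big_mkord xpredT (fun i => 1 - mono 1 (bump 0 i).+1)).
by rewrite (big_addn 0 _ 2) subn2 /=; apply: eq_bigr => i _; rewrite /bump addn2.
Qed.

Lemma qp_drop j : \prod_(i < j) (1 - mono z 1 * mono 1 i) * qp z j.+1 1 = qp z 1 1.
Proof.
elim: j => [|j IH]; first by rewrite big_ord0 mul1r.
rewrite big_ord_recr /= -mulrA -IH; congr (_ * _).
by rewrite [RHS]qp_recl // monoM mulr1 add1n addn1.
Qed.

Lemma near0_noones : near0 crank_noones.
Proof.
by move=> L; rewrite /crank_noones; case: ifP => // _; apply: eqmod_mono0.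
Qed.

Lemma near0_ones : near0 crank_ones.
Proof.
by move=> L; rewrite /crank_ones; case: ifP => // _; apply: eqmod_mono0.
Qed.

(** Two cases of [q_binomial]: f = 0, c = z sums the partitions without ones, and f = zq, c = 1/z
    those with ones. The second has product (q^2; q)_oo, which 1 - q completes to (q; q)_oo. *)
Lemma crank_product :
  (1 - mono 1 1 + mono z 1 + lsum crank_noones + lsum crank_ones)
   * qp z 1 1 * qp z^-1 1 1 = qp 1 1 1.
Proof.
pose D j : ps K := \prod_(i < j) (1 - mono 1 i.+1).
have D0 j : D j 0%N = 1.
  by rewrite /D -(big_mkord xpredT (fun i => 1 - mono 1 i.+1)); apply: prod_cf0 => i _ /=; rewrite subr0.
have D00 : psinv (D 0%N) = 1.
  by have := psinvP (f := D 0%N); rewrite D0 {1}/D big_ord0 mul1r; apply; rewrite oner_eq0.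
have DI j : D j * psinv (D j) = 1 by apply: psinvP; rewrite D0 oner_eq0.
have n0 (u : nat -> ps K) (d : K) : near0 (fun j => u j * mono (d ^+ j) j).
  by move=> j; rewrite mulrC; apply: eqmod_mono0.
have E1 := q_binomial 0 z; rewrite (eq_iprod (v := fun=> 1)) in E1; last first.
  by move=> k; rewrite mul0r subr0.
have E2 := q_binomial (mono z 1) z^-1.
rewrite (eq_iprod (v := qfac 1 2 1)) in E2; last first.
  by move=> k; rewrite /qfac monoM divff // mul1n add1n.
have -> : qp 1 1 1 = (1 - mono 1 1) * qp 1 2 1 :> ps K by rewrite qp_recl.
rewrite -[qp 1 2 1]E2 mulrC [RHS]mulrCA; congr (_ * _).
set u := fun j => _ in E2 *; set v := fun j => _ in E1.
have near0u : near0 u by apply: n0.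
have near0v : near0 v by apply: n0.
have nearS (w : nat -> ps K) : near0 w -> near0 (w \o S).
  by move=> Hw j n nj; apply: Hw; lia.
have tailI j : (0 < j)%N -> (1 - mono 1 1) * psinv (D j) = psinv (qtail j).
  move=> j0; apply: (@ps_mulI _ (qtail j)); first by rewrite qtail_cf0 oner_eq0.
  by rewrite psinvP ?qtail_cf0 ?oner_eq0 // mulrCA mulrA qtailE // DI.
have uS j : (1 - mono 1 1) * u j.+1 = qp z 1 1 * crank_ones j.+1.
  have c0 : (qtail j.+1 * qp z j.+2 1) 0%N != 0.
    by rewrite cfM0 qtail_cf0 qp_cf0 // mulr1 oner_eq0.
  apply: (ps_mulI c0); rewrite /crank_ones /=.
  rewrite [in RHS]mulrCA [X in _ = _ * X]mulrCA psinvP // mulr1 /u.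
  rewrite -(qp_drop j.+1) -/(D j.+1).
  transitivity (((1 - mono 1 1) * psinv (D j.+1)) * qtail j.+1 * (\prod_(i < j.+1) (1 - mono z 1 * mono 1 i) * qp z j.+2 1) * mono (z^-1 ^+ j.+1) j.+1).
    by ring.
  by rewrite tailI // [psinv _ * _]mulrC psinvP ?qtail_cf0 ?oner_eq0 // mul1r.
have vE j : v j = psinv (D j) * mono (z ^+ j) j.
  by rewrite /v big1 ?mul1r // => i _; rewrite mul0r subr0.
have vS j : (1 - mono 1 1) * v j.+2 = crank_noones j.+2.
  by rewrite vE mulrA tailI // mulrC.
have ones_part : (1 - mono 1 1) * lsum (u \o S) = qp z 1 1 * lsum crank_ones.
  rewrite [LHS]lsumMl; last exact: (nearS _ near0u).
  rewrite (eq_lsum (v := fun j => qp z 1 1 * (crank_ones \o S) j)) => [|j]; last exact: uS.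
  rewrite -lsumMl; last exact: (nearS _ near0_ones).
  by rewrite [in RHS](lsum_recl near0_ones) add0r.
have noones_part : (1 - mono 1 1) * lsum v = 1 - mono 1 1 + mono z 1 + lsum crank_noones.
  rewrite (lsum_recl near0v) lsum_recl; last exact: (nearS _ near0v).
  rewrite (lsum_recl near0_noones) [X in _ = _ + (_ + X)]lsum_recl; last exact: (nearS _ near0_noones).
  rewrite /= !mulrDr lsumMl; last exact: (nearS _ (nearS _ near0v)).
  rewrite (eq_lsum (v := (crank_noones \o S) \o S)) => [|j]; last exact: vS.
  rewrite !vE [crank_noones 0]/= [crank_noones 1]/= !add0r addrA; congr (_ + _ + _).
    by rewrite D00 expr0 mono1 !mulr1.
  by rewrite mulrA tailI // /qtail big_geq // -[psinv 1]mul1r psinvP ?mul1r ?expr1 // oner_eq0.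
rewrite (lsum_recl near0u) [RHS]mulrDr ones_part [LHS]mulrC [LHS]mulrDr; congr (_ + _).
have i1 : iprod (fun=> 1) = 1 :> ps K by apply/psP => n /=; rewrite big1.
rewrite -noones_part mulrCA E1 i1 mulr1 /u.
by rewrite big_ord0 -/(D 0%N) D00 expr0 mono1 !mulr1.
Qed.

End CrankProduct.

(** * Partitions sorted by their number of ones and by their largest part *)

Section CrankCombinatorics.
Variables (K : fieldType) (z : K).
Hypothesis z0 : z != 0.

Lemma mono_prod (I : Type) (r : seq I) (c : I -> K) (e : I -> nat) :
  \prod_(i <- r) mono (c i) (e i) = mono (\prod_(i <- r) c i) (\sum_(i <- r) e i).
Proof. by elim/big_rec3: _ => [|i x y f _ ->]; rewrite ?mono1 ?monoM. Qed.

(** Expanding the product chooses a multiplicity for every part size, hence a function mu;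
    coefficient n keeps those that are partitions of n. *)
Lemma partition_gf n (phi : nat -> nat -> K) :
  (\prod_(i < n) \sum_(k < n.+1) mono (phi i k) (i.+1 * k)) n =
  \sum_(mu : {ffun 'I_n -> 'I_n.+1} | is_partition mu) \prod_(i < n) phi i (mu i).
Proof.
rewrite bigA_distr_bigA cf_sum [RHS]big_mkcond; apply: eq_bigr => mu _.
by rewrite mono_prod /= /is_partition eq_sym.
Qed.

(** Sharper than [iprod_approx], as it uses the starting exponent a: for parts larger than j, n + 1
    - j factors must suffice. *)
Lemma qp_approx c a m N M : (0 < m)%N -> (N <= a + m * M)%N ->
  eqmod N (\prod_(i < M) qfac c a m i) (qp c a m : ps K).
Proof.
move=> m0 NM.
apply: (@eqmod_trans _ _ _ (\prod_(i < M + N) qfac c a m i)); last first.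
  by apply: iprod_approx; [exact: near1_qfac|exact: leq_addl].
have H L : eqmod N (\prod_(i < M) qfac c a m i) (\prod_(i < M + L) qfac c a m i).
  elim: L => [|L IH]; first by rewrite addn0.
  rewrite addnS big_ord_recr /= -[X in eqmod _ X _]mulr1; apply: eqmodM => //.
  rewrite -[X in eqmod _ X _]subr0; apply: eqmodB => //.
  by apply: eqmod_sym; rewrite -[mono _ _]mulr1; apply: eqmod_mono0; nia.
exact: H.
Qed.

Lemma geometric_sum (w : K) s n : (0 < s)%N ->
  eqmod n.+1 ((1 - mono w s) * \sum_(k < n.+1) mono (w ^+ k) (s * k)) 1.
Proof.
move=> s0; rewrite (eq_bigr (fun k : 'I_n.+1 => mono w s ^+ k)) => [|k _]; last by rewrite monoX.
rewrite -opprB mulNr -subrX1 opprB -[X in eqmod _ _ X]subr0; apply: eqmodB => //.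
by rewrite monoX -[mono _ _]mulr1; apply: eqmod_mono0; rewrite leq_pmull.
Qed.

Lemma eqmod_prod1 N (I : eqType) (r : seq I) (F : I -> ps K) :
  (forall i, i \in r -> eqmod N (F i) 1) -> eqmod N (\prod_(i <- r) F i) 1.
Proof.
by move=> /eqmod_prod; rewrite [X in eqmod _ _ X]big1.
Qed.

Lemma ones_gf n j : (0 < j <= n)%N ->
  \sum_(mu : {ffun 'I_n -> 'I_n.+1} | is_partition mu && (ones mu == j))
     z ^ ((nlarger mu)%:Z - j%:Z) = crank_ones z j n.
Proof.
case: n => [|n] /andP[j0 jn]; first by case: j j0 jn.
(* Every part larger than j, that is, every part counted by [nlarger], has weight z; the number of
   ones is forced to be j and has weight z^(-j). *)
pose w s := if (j < s)%N then z else 1.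
pose phi i k := (if i == 0%N then if k == j then z^-1 ^+ j else 0 else 1) * w i.+1 ^+ k.
have onesE (mu : {ffun 'I_n.+1 -> 'I_n.+2}) : ones mu = mu ord0.
  by rewrite /ones (big_pred1 ord0) // => i; rewrite -val_eqE.
have -> : crank_ones z j n.+1 = (\prod_(i < n.+1) \sum_(k < n.+2) mono (phi i k) (i.+1 * k)) n.+1.
  have -> : crank_ones z j = mono (z^-1 ^+ j) j * psinv (qtail K j * qp z j.+1 1).
    by rewrite /crank_ones eqn0Ngt j0.
  pose S s : ps K := \sum_(k < n.+2) mono (w s ^+ k) (s * k).
  have -> : \prod_(i < n.+1) \sum_(k < n.+2) mono (phi i k) (i.+1 * k)
    = mono (z^-1 ^+ j) j * \prod_(2 <= s < n.+2) S s.
    rewrite big_ord_recl; congr (_ * _).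
      rewrite (bigD1 (inord j)) //= big1 ?addr0 => [|k /eqP kj].
        by rewrite inordK // /phi /= eqxx /w (ltnNge j) j0 expr1n mulr1 mul1n.
      rewrite /phi /= ifF ?mul0r //; last by apply/eqP => E; apply: kj; rewrite -E inord_val.
      by apply/psP => i /=; case: eqP.
    rewrite (big_addn 0 _ 2) subn2 /= big_mkord; apply: eq_bigr => i _.
    by apply: eq_bigr => k _; rewrite /phi /= mul1r /bump addn2.
  have c0 : (qtail K j * qp z j.+1 1) 0%N != 0 by rewrite cfM0 qtail_cf0 qp_cf0 // mulr1 oner_eq0.
  suff E : eqmod n.+2 (mono (z^-1 ^+ j) j * psinv (qtail K j * qp z j.+1 1))
     (mono (z^-1 ^+ j) j * \prod_(2 <= s < n.+2) S s) by apply: E.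
  apply: (ps_regular c0).
  rewrite mulrCA psinvP // mulr1 mulrCA -[X in eqmod _ X _]mulr1.
  apply: eqmodM => //; apply: eqmod_sym.
  apply: (@eqmod_trans _ _ _ (\prod_(2 <= s < n.+2) ((1 - mono (w s) s) * S s))).
    rewrite big_split; apply: eqmodM => //.
    rewrite (@big_cat_nat _ _ _ j.+1) //=; apply: eqmodM.
      have -> // : \prod_(2 <= s < j.+1) (1 - mono (w s) s) = qtail K j.
      by apply: eq_big_nat => s /andP[_ sj]; rewrite /w ltnNge -ltnS sj.
    have -> : \prod_(j.+1 <= s < n.+2) (1 - mono (w s) s) = \prod_(i < n.+1 - j) qfac z j.+1 1 i.
      rewrite (big_addn 0 _ j.+1) subSS big_mkord; apply: eq_bigr => i _.
      by rewrite /w /qfac ltn_addl ?mul1n 1?addnC.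
    by apply: eqmod_sym; apply: qp_approx => //; lia.
  apply: eqmod_prod1 => s; rewrite mem_index_iota => /andP[s2 _].
  by apply: geometric_sum; apply: ltnW.
rewrite partition_gf big_mkcondr; apply: eq_bigr => mu pmu; rewrite onesE.
rewrite /phi big_split /= [X in _ = X * _]big_ord_recl /= [X in _ = _ * X * _]big1 ?mulr1 //.
case: eqP => [mj|]; last by rewrite mul0r.
rewrite expfzDr // mulrC exprVn -exprnN -exprnP; congr (_ * _).
rewrite /nlarger onesE mj expr_sum big_mkcond; apply: eq_bigr => i _.
by rewrite /w; case: ifP => _; rewrite ?expr1n.
Qed.

Lemma onesE n (mu : {ffun 'I_n.+1 -> 'I_n.+2}) : ones mu = mu ord0.
Proof. by rewrite /ones (big_pred1 ord0) // => i; rewrite -val_eqE. Qed.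

(** Turns a condition on a maximum into one condition per multiplicity, so that the generating
    function becomes a product over part sizes. *)
Lemma largest_partP n (mu : {ffun 'I_n -> 'I_n.+1}) L : (0 < L <= n)%N ->
  reflect (forall i : 'I_n, if i.+1 == L then (0 < mu i)%N
                            else (L < i.+1)%N ==> (mu i == 0 :> nat))
          (largest_part mu == L).
Proof.
case/andP=> L0 Ln; apply: (iffP eqP) => [<- i|H].
  have le i' : (0 < mu i')%N -> (i'.+1 <= largest_part mu)%N.
    by move=> m0; apply: (leq_bigmax_cond (F := fun i : 'I_n => i.+1)).
  case: eqP => [E|_]; last first.
    by apply/implyP => lt; rewrite eqn0Ngt; apply: contraL lt => /le; rewrite -leqNgt.
  rewrite lt0n; apply/negP => /eqP mi.
  suff : (largest_part mu <= i)%N by rewrite -E ltnn.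
  apply/bigmax_leqP => i' mi'; rewrite ltn_neqAle -ltnS E le // andbT.
  by apply/eqP => ii; move: mi'; rewrite (val_inj ii) mi.
apply/eqP; rewrite eqn_leq; apply/andP; split.
  apply/bigmax_leqP => i mi; have := H i; case: eqP => [-> //|_].
  by case: leqP => //= _ /eqP E; rewrite E in mi.
case: L L0 Ln H => // L _ Ln H.
by apply: (leq_bigmax_cond (F := fun i : 'I_n => i.+1) (Ordinal Ln)); have := H (Ordinal Ln); rewrite eqxx.
Qed.

Lemma noones_gf n L : (1 < L <= n)%N ->
  \sum_(mu : {ffun 'I_n -> 'I_n.+1} |
        is_partition mu && ((ones mu == 0%N) && (largest_part mu == L))) z ^ L%:Z
  = crank_noones z L n.
Proof.
case: n => [|n] /andP[L1 Ln]; first by case: L L1 Ln.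
have L0 : (0 < L)%N by apply: ltnW.
pose ok i k := if i == 0%N then k == 0%N else
  if i.+1 == L then (0 < k)%N else (L < i.+1)%N ==> (k == 0%N).
have okP (mu : {ffun 'I_n.+1 -> 'I_n.+2}) :
    (ones mu == 0%N) && (largest_part mu == L) = [forall i, ok (nat_of_ord i) (mu i)].
  have c : (0 < L <= n.+1)%N by rewrite L0.
  rewrite onesE; apply/andP/forallP => [[m0 /(largest_partP _ c) H] i|H].
    rewrite /ok; case: (posnP i) => [i0|i0]; last exact: (H i).
    by rewrite (_ : i = ord0) //; apply: val_inj.
  have m0 := H ord0; rewrite /ok eqxx in m0; split=> //.
  apply/(largest_partP _ c) => i; have := H i; rewrite /ok; case: (posnP i) => [i0|i0]; last by [].
  move=> _; rewrite i0; case: eqP => [E|_]; first by rewrite -E in L1.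
  by rewrite ltnNge L0.
rewrite (eq_bigl (fun mu : {ffun 'I_n.+1 -> 'I_n.+2} => is_partition mu && [forall i, ok (nat_of_ord i) (mu i)])) => [|mu]; last by rewrite okP.
pose phi i k : K := (ok i k)%:R.
have -> : crank_noones z L n.+1 = z ^ L%:Z * (\prod_(i < n.+1) \sum_(k < n.+2) mono (phi i k) (i.+1 * k)) n.+1.
  have -> : crank_noones z L = mono (z ^+ L) L * psinv (qtail K L).
    by rewrite /crank_noones ltnNge L1.
  pose S s : ps K := \sum_(k < n.+2) mono (phi s.-1 k) (s * k).
  have -> : \prod_(i < n.+1) \sum_(k < n.+2) mono (phi i k) (i.+1 * k) = \prod_(2 <= s < n.+2) S s.
    rewrite big_ord_recl big_ord_recl /= {1}/phi /ok eqxx muln0 mono1.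
    rewrite big1 ?addr0 ?mul1r => [|k _]; last first.
      by rewrite /phi /ok /=; apply/psP => i /=; case: eqP.
    rewrite (big_addn 0 _ 2) subn2 /= big_mkord; apply: eq_bigr => i _.
    by rewrite /S /bump addn2.
  have c0 : qtail K L 0%N != 0 by rewrite qtail_cf0 oner_eq0.
  suff E : eqmod n.+2 (mono (z ^+ L) L * psinv (qtail K L))
     (mono (z ^+ L) 0 * \prod_(2 <= s < n.+2) S s).
    by rewrite E // mono_mulE /= subn0.
  apply: (ps_regular c0).
  rewrite mulrCA psinvP // mulr1 mulrCA.
  have -> : mono (z ^+ L) L = mono (z ^+ L) 0 * mono 1 L by rewrite monoM mulr1.
  apply: eqmodM => //; apply: eqmod_sym.
  (* The comparison is made factor by factor: a full geometric series below L, just 1 above L, and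
     at L the series without its first term, which produces q^L. *)
  pose T s : ps K := if (s <= L)%N then 1 - mono 1 s else 1.
  have -> : qtail K L = \prod_(2 <= s < n.+2) T s.
    have T1 : \prod_(L.+1 <= s < n.+2) T s = 1.
      by rewrite big_nat big1 // => s /andP[sL _]; rewrite /T leqNgt sL.
    rewrite [RHS](@big_cat_nat _ _ _ L.+1) //= T1 mulr1.
    by apply: eq_big_nat => s /andP[_ sj]; rewrite /T -ltnS sj.
  rewrite -big_split /=.
  have -> : mono 1 L = \prod_(2 <= s < n.+2) (if s == L then mono 1 L else 1) :> ps K.
    rewrite (bigD1_seq L) ?mem_index_iota ?iota_uniq ?L1 ?ltnS //= eqxx.
    by rewrite big1 ?mulr1 // => s /negPf ->.
  apply: eqmod_prod => s; rewrite mem_index_iota => /andP[s2 sn].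
  have sE : s.-1.+1 = s by rewrite prednK // ltnW.
  have s1 : (s.-1 == 0%N) = false by lia.
  rewrite /S /T; case: (ltngtP s L) => sL.
  - rewrite (eq_bigr (fun k : 'I_n.+2 => mono (1 ^+ k) (s * k))) => [|k _].
      by apply: geometric_sum; apply: ltnW.
    by rewrite /phi /ok s1 sE (ltn_eqF sL) (ltnNge L) (ltnW sL) expr1n.
  - rewrite mul1r big_ord_recl big1 ?addr0 => [|k _].
      by rewrite /phi /ok s1 sE sL (gtn_eqF sL) muln0 mono1.
    by rewrite /phi /ok s1 sE sL (gtn_eqF sL); apply/psP => i /=; case: eqP.
  - rewrite sL in s1 sE *; have G := @geometric_sum 1 L n.+1 L0.
    rewrite big_ord_recl mulrDr in G.
    rewrite big_ord_recl (_ : mono (phi L.-1 (ord0 : 'I_n.+2)) _ = 0); last first.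
      by rewrite /phi /ok s1 sE eqxx /=; apply/psP => i /=; case: eqP.
    rewrite add0r (eq_bigr (fun k : 'I_n.+1 => mono (1 ^+ lift ord0 k) (L * lift ord0 k))) => [|k _].
      rewrite [X in eqmod _ _ X](_ : mono 1 L = 1 - (1 - mono 1 L) * mono (1 ^+ (ord0 : 'I_n.+2)) (L * (ord0 : 'I_n.+2))); last first.
        by rewrite /= muln0 expr0 mono1; ring.
      have := eqmodB G (@eqmod_refl K n.+2 ((1 - mono 1 L) * mono (1 ^+ (ord0 : 'I_n.+2)) (L * (ord0 : 'I_n.+2)))).
      by rewrite [X in eqmod _ X _ -> _]addrAC subrr add0r.
    by rewrite /phi /ok s1 sE eqxx expr1n.
rewrite partition_gf mulr_sumr big_mkcondr; apply: eq_bigr => mu pmu.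
case: forallP => [H|H].
  by rewrite big1 ?mulr1 // => i _; rewrite /phi H.
suff /eqP -> : \prod_(i < n.+1) phi i (mu i) == 0 by rewrite mulr0.
rewrite prodf_seq_eq0; apply/hasP.
have /existsP [i Hi] : [exists i : 'I_n.+1, ~~ ok (nat_of_ord i) (mu i)].
  by rewrite -negb_forall; apply/forallP.
by exists i; rewrite ?mem_index_enum //= /phi (negPf Hi).
Qed.

Lemma crank_total n : (1 < n)%N ->
  \sum_(mu : {ffun 'I_n -> 'I_n.+1} | is_partition mu) z ^ crank mu
  = (lsum (crank_noones z) + lsum (crank_ones z)) n.
Proof.
move=> n1; have n0 : (0 < n)%N by apply: ltnW.
have ones_le (mu : {ffun 'I_n -> 'I_n.+1}) : (ones mu < n.+1)%N.
  by case: n n1 n0 mu => // n _ _ mu; rewrite onesE ltn_ord.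
have large_le (mu : {ffun 'I_n -> 'I_n.+1}) : (largest_part mu < n.+1)%N.
  by rewrite ltnS; apply/bigmax_leqP => i _.
rewrite (partition_big (fun mu => Ordinal (ones_le mu)) xpredT) //=.
rewrite big_ord_recl; congr (_ + _).
  rewrite (eq_bigr (fun mu : {ffun 'I_n -> 'I_n.+1} => z ^ (largest_part mu)%:Z)) => [|mu]; last first.
    by case/andP=> _ /eqP /(congr1 val) /= E; rewrite /crank E.
  rewrite (partition_big (fun mu => Ordinal (large_le mu)) xpredT) //=.
  rewrite cf_sum; apply: eq_bigr => L _.
  have [L1|L1] := ltnP L 2; last first.
    rewrite -noones_gf; last by rewrite L1 -ltnS /=.
    rewrite [RHS](eq_bigl (fun mu : {ffun 'I_n -> 'I_n.+1} =>
       is_partition mu && (Ordinal (ones_le mu) == ord0) && (Ordinal (large_le mu) == L))).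
      by apply: eq_bigr => mu /andP[_ /eqP /(congr1 val) /= ->].
    by move=> mu; rewrite -!val_eqE /= andbA.
  rewrite /crank_noones L1 big1 // => mu /andP[/andP[pmu /eqP /(congr1 val) /= m0] /eqP /(congr1 val) /= mL].
  (* Largest part at most 1 and no ones leave only the empty partition, contrary to n > 1. *)
  exfalso; have : (\sum_(i < n) (i.+1 * mu i)%N)%N = 0%N; last by move/eqP: pmu; lia.
  rewrite big1 // => i _.
  have [mi|mi] := posnP (mu i); first by rewrite mi muln0.
  have := @leq_bigmax_cond _ (fun i => (0 < mu i)%N) (fun i : 'I_n => i.+1) i mi.
  rewrite -/(largest_part mu) mL => le.
  have : (mu i <= ones mu)%N by rewrite /ones (bigD1 i) ?leq_addr //; apply/eqP; lia.
  by rewrite m0; lia.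
transitivity (\sum_(j < n) crank_ones z j.+1 n); last first.
  by rewrite cf_sum big_ord_recl /= add0r.
apply: eq_bigr => j _.
rewrite -ones_gf; last by rewrite /= ltn_ord.
rewrite (eq_bigl (fun mu : {ffun 'I_n -> 'I_n.+1} => is_partition mu && (ones mu == j.+1))).
  by apply: eq_bigr => mu /andP[_ /eqP E]; rewrite /crank E.
by move=> mu; rewrite -val_eqE.
Qed.

End CrankCombinatorics.

Lemma crank_bound n (mu : {ffun 'I_n -> 'I_n.+1}) :
  is_partition mu -> - n%:Z <= crank mu <= n%:Z.
Proof.
move=> /eqP pmu.
have le1 (P : pred 'I_n) : (\sum_(i < n | P i) mu i <= n)%N.
  rewrite -[X in (_ <= X)%N]pmu big_mkcond; apply: leq_sum => i _.
  by case: ifP => // _; rewrite leq_pmull.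
have l1 : (largest_part mu <= n)%N by apply/bigmax_leqP => i _.
have l2 : (ones mu <= n)%N by apply: le1.
have l3 : (nlarger mu <= n)%N by apply: le1.
by rewrite /crank; case: eqP => _; lia.
Qed.

Lemma sum_Mcrank (K : fieldType) (g : int -> K) n : (1 < n)%N ->
  \sum_(k < (2 * n).+1) (Mcrank (k%:Z - n%:Z) n)%:~R * g (k%:Z - n%:Z) =
  \sum_(mu : {ffun 'I_n -> 'I_n.+1} | is_partition mu) g (crank mu).
Proof.
move=> n1.
(* The reduction modulo 2n + 1 only makes the index an ordinal for every mu; on partitions
   [crank_bound] shows that it changes nothing. *)
have lt (mu : {ffun 'I_n -> 'I_n.+1}) : (absz (crank mu + n%:Z)%R %% (2 * n).+1 < (2 * n).+1)%N.
  exact: ltn_pmod.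
rewrite (partition_big (fun mu => Ordinal (lt mu)) xpredT) //=.
apply: eq_bigr => k _; rewrite /Mcrank n1.
rewrite -pmulrn -sum1_card natr_sum mulr_suml.
rewrite [LHS](eq_bigl (fun mu : {ffun 'I_n -> 'I_n.+1} => is_partition mu && (Ordinal (lt mu) == k))) => [|mu].
  apply: eq_bigr => mu /andP[/crank_bound bd /eqP /(congr1 val) /= E]; rewrite mul1r.
  by congr g; move: E; rewrite modn_small; lia.
rewrite inE; case pmu: (is_partition mu) => //=.
have := crank_bound pmu => bd.
rewrite -val_eqE /= modn_small; last by lia.
by apply/eqP/eqP; lia.
Qed.

Section CrankSeries.
Variables (K : fieldType) (z : K).
Hypothesis z0 : z != 0.

Definition crank_series : ps K := PS (fun n =>
  \sum_(k < (2 * n).+1) (Mcrank (k%:Z - n%:Z) n)%:~R * z ^ (k%:Z - n%:Z)).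

(** The conventions at n <= 1 amount to 1 + (-1 + z + 1/z) q. The term q/z is already the value of
    [crank_ones] at the partition of 1, so 1 - q + zq is the whole correction. *)
Lemma crank_seriesE :
  crank_series = 1 - mono 1 1 + mono z 1 + lsum (crank_noones z) + lsum (crank_ones z).
Proof.
apply/psP => -[|[|n]].
- rewrite /= !big_ord_recl !big_ord0 /= /crank_noones /crank_ones /= /Mcrank /=.
  by rewrite !addr0 subr0 expr0z mulr1.
- have lsum1 (u : nat -> ps K) : lsum u 1%N = u 0%N 1%N + u 1%N 1%N.
    by rewrite /= big_ord_recr big_ord1.
  have ones1 : crank_ones z 1 1%N = z^-1.
    have c0 : (qtail K 1 * qp z 2 1) 0%N = 1 by rewrite cfM0 qtail_cf0 qp_cf0 // mulr1.
    have := psinvP (f := qtail K 1 * qp z 2 1); rewrite c0 oner_eq0 => /(_ isT).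
    move=> /(congr1 (fun f : ps K => f 0%N)); rewrite cfM0 c0 mul1r => E.
    have -> : crank_ones z 1 = mono (z^-1 ^+ 1) 1 * psinv (qtail K 1 * qp z 2 1) by [].
    by rewrite mono_mulE subnn E expr1 mulr1.
  rewrite !cfD !lsum1 ones1 /= !big_ord_recl !big_ord0 /= /Mcrank /=.
  rewrite -[z ^ (0%:Z - 1%:Z)]/(z^-1) -[z ^ (Posz (bump 0 0) - 1%:Z)]/(1 : K).
  rewrite -[z ^ (Posz (bump 0 (bump 0 0)) - 1%:Z)]/(z ^+ 1) expr1.
  by rewrite mulrN1z; ring.
rewrite -addrA cfD -crank_total // -sum_Mcrank // !cfD.
by rewrite [X in X + _](_ : _ = 0) ?add0r // /= ; ring.
Qed.

Theorem crank_generating_function :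
  crank_series * qp z 1 1 * qp z^-1 1 1 = qp 1 1 1.
Proof. by rewrite crank_seriesE crank_product. Qed.

End CrankSeries.

(** * The crank at an eleventh root of unity *)

Section Polynomials.
Variable K : fieldType.

Definition ps_poly (p : {poly K}) : ps K := PS (fun n => p`_n).

Lemma ps_polyM p q : ps_poly (p * q) = ps_poly p * ps_poly q.
Proof. by apply/psP => n; rewrite /= coefM. Qed.

Lemma ps_poly_prod (I : Type) (r : seq I) (F : I -> {poly K}) :
  ps_poly (\prod_(i <- r) F i) = \prod_(i <- r) ps_poly (F i).
Proof.
elim/big_rec2: _ => [|i p f _ <-]; last exact: ps_polyM.
by apply/psP => n; rewrite /= coef1.
Qed.

Lemma ps_poly_factor c e : ps_poly (1 - c *: 'X^e) = 1 - mono c e.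
Proof.
apply/psP => n; rewrite /= coefB coef1 coefZ coefXn; congr (_ - _).
by case: eqP => _; rewrite ?mulr1 ?mulr0.
Qed.

Lemma root_product (z : K) e : 11.-primitive_root z ->
  \prod_(k < 11) (1 - mono (z ^+ k) e) = 1 - mono 1 (11 * e).
Proof.
move=> zP; have z11 := prim_expr_order zP.
have z0 : z != 0 by apply/eqP => E; move: z11; rewrite E expr0n => /eqP; rewrite eq_sym oner_eq0.
(* The roots of the factors 1 - z^k X are the inverse powers of z, that is, the powers of z^10. *)
have zP' : 11.-primitive_root (z ^+ 10) by rewrite prim_root_exp_coprime.
have E : \prod_(k < 11) (1 - z ^+ k *: 'X) = 1 - 'X^11 :> {poly K}.
  have F := factor_Xn_sub_1 zP'; rewrite big_mkord in F.
  rewrite -opprB -F.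
  transitivity (\prod_(k < 11) ((- z ^+ k)%:P * ('X - (z ^+ 10 ^+ k)%:P))).
    apply: eq_bigr => k _; rewrite mulrBr -polyCM mulNr -exprM -exprD.
    by rewrite -mulSn exprM z11 expr1n !polyCN opprK mulNr mul_polyC polyC1 addrC.
  rewrite big_split /= -rmorph_prod /= (_ : \prod_(k < 11) - z ^+ k = -1) ?mulN1r ?polyCN ?mulN1r //.
  by rewrite !big_ord_recr big_ord0 /=; ring: z11.
have := congr1 (fun p => ps_poly (p \Po 'X^e)) E; rewrite /= rmorph_prod /= ps_poly_prod.
rewrite rmorphB rmorph1 rmorphXn /= comp_polyX -exprM mulnC -[X in 1 - X]scale1r ps_poly_factor => <-.
apply: eq_bigr => k _; rewrite -ps_poly_factor.
by rewrite comp_polyB comp_polyZ comp_polyX (rmorph1 (comp_poly 'X^e)).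
Qed.
End Polynomials.

Section CrankDissection.
Variables (K : fieldType) (z : K).
Hypotheses (two0 : 2 != 0 :> K) (zP : 11.-primitive_root z).

Lemma qp_roots : \prod_(k < 11) qp (z ^+ k) 1 1 = qp 1 11 11.
Proof.
apply: eqmodP => N.
apply: (@eqmod_trans _ _ _ (\prod_(k < 11) \prod_(i < N) qfac (z ^+ k) 1 1 i)).
  by apply: eqmod_prod => k _; apply/eqmod_sym/iprod_approx => //; apply: near1_qfac.
rewrite exchange_big /= (eq_bigr (fun i : 'I_N => qfac 1 11 11 i)) => [|i _].
  by apply: iprod_approx => //; apply: near1_qfac.
by rewrite /qfac root_product // !mul1n mulnDr muln1.
Qed.

(** The four theta factors contain (q)_oo four times: two copies cancel against Winquist's square,
    and one more is traded for F(z) (zq)_oo (q/z)_oo. Primitivity of z makes the constant D nonzero,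
    so it can be cancelled too. *)
Lemma crank_dissect :
  crank_series z * qp 1 11 11 =
  \sum_(i < 10) mono (term_coef z i) 0 * winq_term K i.
Proof.
have z11 := prim_expr_order zP.
have z0 : z != 0 by apply/eqP => E; move: z11; rewrite E expr0n => /eqP; rewrite eq_sym oner_eq0.
have zV k : (k <= 11)%N -> (z ^+ k)^-1 = z ^+ (11 - k).
  move=> k11; have zk0 : z ^+ k != 0 by rewrite expf_neq0.
  by apply: (mulIf zk0); rewrite mulVf // -exprD subnK // z11.
pose P k := qp (z ^+ k) 1 1.
have jacE k : (0 < k <= 11)%N ->
    jac 0 1 (z ^+ k) = mono (1 - z ^+ k) 0 * P k * P (11 - k)%N * P 0%N.
  case/andP=> k0 k11; have zk0 : z ^+ k != 0 by rewrite expf_neq0.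
  rewrite -jacobi_triple_product // qp_recl // zV // subn0 /P expr0 monoD monoN mono1.
  by rewrite add0n.
have zk1 k : (0 < k < 11)%N -> 1 - z ^+ k != 0.
  case/andP=> k0 k11; rewrite subr_eq0 eq_sym -(prim_order_dvd zP) gtnNdvd //.
have P0 : P 0%N 0%N = 1 by rewrite /P expr0 qp_cf0.
have W := @winquist K 1 isT (z ^+ 5) (z ^+ 2) 0 0 (expf_neq0 _ z0) (expf_neq0 _ z0) isT isT.
have E3 : z ^+ 5 / z ^+ 2 = z ^+ 3 by rewrite -expfB.
rewrite -exprD E3 !jacE // (winq_dissect two0 z11) in W.
set S := \sum_(i < 10) _ in W *.
have zV1 : z^-1 = z ^+ 10 by have := zV 1%N isT; rewrite expr1.
have C : crank_series z * P 1%N * P 10%N = P 0%N.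
  by have := crank_generating_function z0; rewrite zV1 /P expr0 expr1.
have Q0 : qp 1 1 1 = P 0%N :> ps K by rewrite /P expr0.
rewrite Q0 in W.
have -> : qp 1 11 11 = P 0%N * P 1%N * P 2%N * P 3%N * P 4%N * P 5%N * P 6%N * P 7%N
    * P 8%N * P 9%N * P 10%N.
  by rewrite -qp_roots !big_ord_recr big_ord0 /= mul1r.
pose D := (1 - z ^+ 5) * (1 - z ^+ 2) * (1 - z ^+ 7) * (1 - z ^+ 3).
have D0 : (mono D 0 * P 0%N ^+ 2) 0%N != 0.
  by rewrite cfM0 expr2 cfM0 P0 !mulr1 /D /= !mulf_neq0 ?zk1.
apply: (ps_mulI D0); transitivity (P 0%N ^+ 2 * (mono D 0 * S)); last by ring.
rewrite -W /D.
have CM c d : mono (c * d) 0 = mono c 0 * mono d 0 :> ps K by rewrite monoM.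
rewrite !CM /subn /=.
have -> : P 0%N ^+ 2 = P 0%N * (crank_series z * P 1%N * P 10%N) by rewrite C.
ring: C.
Qed.
End CrankDissection.

(** * From Winquist products to the quotients of the X_i *)

Section ThetaQuotients.
Variable K : fieldType.

Definition theta11 (i : nat) : ps K :=
  qp 1 (11 * i) 121 * (qp 1 (121 - 11 * i) 121 * qp 1 121 121).

Let J : ps K := qp 1 121 121.

Lemma theta11_jac i : (i <= 11)%N -> jac (11 * i) 121 1 = theta11 i.
Proof.
move=> i11; rewrite -jacobi_triple_product ?oner_eq0 //; last by lia.
by rewrite invr1 /theta11 mulrA.
Qed.

Lemma theta11_sym i : (i <= 11)%N -> theta11 (11 - i) = theta11 i.
Proof.
move=> i11; rewrite /theta11 mulrCA (_ : (121 - 11 * (11 - i) = 11 * i)%N) ?mulnBr //; lia.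
Qed.

Lemma theta11_winq x y : (y < x)%N -> (x <= 5)%N ->
  theta11 x * theta11 y * theta11 (x + y) * theta11 (x - y)
  = J ^+ 2 * winq 121 1 1 (11 * x) (11 * y).
Proof.
move=> yx x5; rewrite -winquist ?oner_eq0 //; [|lia..].
by rewrite -mulnDr -mulnBr divr1 mulr1 !theta11_jac //; lia.
Qed.

(** The five theta functions contain each class 11 r modulo 121 with 1 <= r <= 10 once, and J five
    times; one J supplies the missing class r = 11 of (q^11; q^11)_oo. *)
Lemma theta11_prod :
  theta11 1 * theta11 2 * theta11 3 * theta11 4 * theta11 5 = qp 1 11 11 * J ^+ 4.
Proof.
rewrite (@qp_split _ 11 1 11 11) // !big_ord_recr big_ord0 /= /theta11 /J /=.
rewrite /muln /subn /addn /=; ring.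
Qed.

Definition theta_num : seq (ps K) :=
  [:: 1; theta11 5; theta11 3; theta11 2; 1; theta11 4; 1; theta11 1; 1; 1].
Definition theta_den : seq (ps K) :=
  [:: theta11 1; theta11 2 * theta11 3; theta11 1 * theta11 4; theta11 1 * theta11 3;
      theta11 2; theta11 2 * theta11 5; theta11 3; theta11 4 * theta11 5;
      theta11 4; theta11 5].

(** By [theta11_winq] and X_(11-i) = X_i the term is a product of four X_i over J^2. Multiplied by
    the denominator listed for it, this product becomes the listed numerator times all five X_i,
    which [theta11_prod] evaluates. *)
Lemma winq_term_quotient i (f : ps K) : (i < 10)%N -> nth 0 theta_den i * f = 1 ->
  winq_term K i =
  qp 1 11 11 * (J ^+ 2 * (mono 1 (nth 0%N term_e i) * (nth 0 theta_num i * f))).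
Proof.
move=> i10 df.
have J0 : (J ^+ 2) 0%N != 0 by rewrite expr2 cfM0 qp_cf0 // mulr1 oner_eq0.
apply: (ps_mulI J0); rewrite /winq_term mulrCA.
have s6 := @theta11_sym 5 isT; have s7 := @theta11_sym 4 isT.
have s8 := @theta11_sym 3 isT; have s9 := @theta11_sym 2 isT.
rewrite /subn /= in s6 s7 s8 s9.
transitivity (mono 1 (nth 0%N term_e i) * ((qp 1 11 11 * J ^+ 4) * nth 0 theta_num i * f)).
  rewrite -theta11_prod; congr (_ * _).
  rewrite -theta11_winq; [|by case: i i10 {df} => [|[|[|[|[|[|[|[|[|[|]]]]]]]]]]..].
  rewrite -[LHS]mulr1 -df.
  case: i i10 {df} => [|[|[|[|[|[|[|[|[|[|]]]]]]]]]] // _; rewrite /= /addn /subn /= ?s6 ?s7 ?s8 ?s9; ring.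
by ring.
Qed.
End ThetaQuotients.

(** * Transfer of the rational series to [algC], where the roots of unity live *)

Section Embedding.

Definition emb (f : fps) : ps algC := PS (fun n => ratr (f n)).

Lemma embD f g : emb (fps_add f g) = emb f + emb g.
Proof. by apply/psP => n; rewrite /= rmorphD. Qed.

Lemma embZ c f : emb (fps_scale c f) = mono (ratr c) 0 * emb f.
Proof. by apply/psP => n; rewrite mono_mulE subn0 /= rmorphM. Qed.

Lemma embM f g : emb (fps_mul f g) = emb f * emb g.
Proof.
apply/psP => n; rewrite /= rmorph_sum; apply: eq_bigr => i _.
by rewrite rmorphM.
Qed.

Lemma emb_shift k f : emb (fps_shift k f) = mono 1 k * emb f.
Proof.
by apply/psP => n; rewrite mono_mulE /= /fps_shift; case: ifP; rewrite ?mul1r ?rmorph0.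
Qed.

Lemma size_fps_inv_seq f n : size (fps_inv_seq f n) = n.+1.
Proof. by elim: n => //= n IH; rewrite size_rcons IH. Qed.

Lemma nth_fps_inv_seq f n i : (i <= n)%N -> nth 0 (fps_inv_seq f n) i = fps_inv f i.
Proof.
elim: n => [|n IH]; first by rewrite leqn0 => /eqP ->.
rewrite leq_eqVlt => /orP[/eqP -> //|i_n]; rewrite ltnS in i_n.
by rewrite /= nth_rcons size_fps_inv_seq ltnS i_n IH.
Qed.

Lemma emb_inv f : f 0%N != 0 -> emb f * emb (fps_inv f) = 1.
Proof.
move=> f0; rewrite -embM; apply/psP => -[|n]; rewrite /= /fps_mul.
  by rewrite big_ord1 /= /fps_inv /= divff // rmorph1.
rewrite big_ord_recl subn0 [fps_inv f n.+1]/fps_inv /= nth_rcons size_fps_inv_seq ltnn eqxx.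
rewrite mulNr mulrN mulrA divff // mul1r big_add1 /= big_mkord.
rewrite (eq_bigr (fun i : 'I_n.+1 => f i.+1 * fps_inv f (n.+1 - i.+1)%N)) => [|i _].
  by rewrite addNr rmorph0.
by rewrite nth_fps_inv_seq // subSS leq_subr.
Qed.

Lemma emb_qpoch a m : emb (qpoch a m) = qp 1 a m.
Proof.
apply/psP => n; rewrite /= /qpoch -coef_map /qpoch_trunc rmorph_prod /=.
rewrite -[LHS]/(ps_poly _ n) ps_poly_prod; congr (cf _ n); apply: eq_bigr => i _.
by rewrite rmorphB rmorph1 /= map_polyXn -[X in 1 - X]scale1r ps_poly_factor.
Qed.

Lemma emb_X i : emb (Defs.X i) = theta11 algC i.
Proof. by rewrite /Defs.X /J2 !embM !emb_qpoch. Qed.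

Lemma theta11_cf0 i : (0 < i < 11)%N -> theta11 algC i 0%N = 1.
Proof. by move=> i11; rewrite /theta11 !cfM0 !qp_cf0 ?mulr1 //; lia. Qed.

Lemma emb_cf0 f : emb f 0%N = 1 -> f 0%N != 0.
Proof. by move=> E; apply/eqP => f0; move: E; rewrite /= f0 rmorph0 => /esym/eqP; rewrite oner_eq0. Qed.

Definition v11_den : seq fps :=
  [:: Defs.X 1; fps_mul (Defs.X 2) (Defs.X 3); fps_mul (Defs.X 1) (Defs.X 4);
      fps_mul (Defs.X 1) (Defs.X 3); Defs.X 2; fps_mul (Defs.X 2) (Defs.X 5);
      Defs.X 3; fps_mul (Defs.X 4) (Defs.X 5); Defs.X 4; Defs.X 5].

Definition v11_term (i : nat) : ps algC :=
  qp 1 121 121 ^+ 2 * (mono 1 (nth 0%N term_e i) *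
    (nth 0 (theta_num algC) i * emb (fps_inv (nth (fun=> 0) v11_den i)))).

Lemma winq_v11_term i : (i < 10)%N -> winq_term algC i = qp 1 11 11 * v11_term i.
Proof.
move=> i10; apply: winq_term_quotient => //.
have -> : nth 0 (theta_den algC) i = emb (nth (fun=> 0) v11_den i).
  by case: i i10 => [|[|[|[|[|[|[|[|[|[|]]]]]]]]]] // _; rewrite /v11_den /theta_den /nth -!emb_X -?embM.
apply: emb_inv; apply: emb_cf0.
by case: i i10 => [|[|[|[|[|[|[|[|[|[|]]]]]]]]]] // _;
  rewrite /v11_den /nth;
  move: (emb_X 1) (emb_X 2) (emb_X 3) (emb_X 4) (emb_X 5);
  move: (Defs.X 1) (Defs.X 2) (Defs.X 3) (Defs.X 4) (Defs.X 5) => X1 X2 X3 X4 X5 E1 E2 E3 E4 E5;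
  rewrite ?embM ?cfM0 ?E1 ?E2 ?E3 ?E4 ?E5 !theta11_cf0 ?mulr1.
Qed.

(** There is no coefficient a_6, so the list positions 6 to 9 hold a_7 to a_10. *)
Lemma emb_v11 (a : seq int) :
  emb (v11 a`_0 a`_1 a`_2 a`_3 a`_4 a`_5 a`_6 a`_7 a`_8 a`_9) =
  mono 11^-1 0 * \sum_(i < 10) mono (a`_i)%:~R 0 * v11_term i.
Proof.
rewrite /v11 embZ fmorphV rmorph_nat.
rewrite !big_ord_recr big_ord0 /= /v11_term /theta_num /v11_den /nth -!emb_X.
move: (Defs.X 1) (Defs.X 2) (Defs.X 3) (Defs.X 4) (Defs.X 5) => X1 X2 X3 X4 X5.
rewrite /fps_div; congr (_ * _).
rewrite !(embM, embD, embZ, emb_shift) !ratr_int -/(qpoch _ _) !emb_qpoch.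
rewrite mono1; ring.
Qed.

End Embedding.

(** * Fourier inversion and the theorem *)

Section FourierInversion.
Variable z : algC.
Hypothesis zP : 11.-primitive_root z.

Let two0 : 2 != 0 :> algC. Proof. by rewrite pnatr_eq0. Qed.
Let z11 : z ^+ 11 = 1. Proof. exact: prim_expr_order. Qed.
Let z0 : z != 0.
Proof. by apply/eqP => E; move: z11; rewrite E expr0n => /eqP; rewrite eq_sym oner_eq0. Qed.

Lemma crank_series_v11 (w : algC) : 11.-primitive_root w ->
  crank_series w = \sum_(i < 10) mono (term_coef w i) 0 * v11_term i.
Proof.
move=> wP; have J0 : (qp 1 11 11 : ps algC) 0%N != 0 by rewrite qp_cf0 // oner_eq0.
apply: (ps_mulI J0); rewrite mulrC crank_dissect // mulr_sumr.
by apply: eq_bigr => i _; rewrite winq_v11_term // mulrCA.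
Qed.

(** At z = 1 the cranks are forgotten; the conventional values at n = 1 still add up to -1 + 1 + 1 =
    p(1). *)
Lemma npart_crank n : crank_series (1 : algC) n = (npart n)%:R.
Proof.
have gf m : (m < 2)%N -> (npart m)%:R = (\prod_(i < m) \sum_(k < m.+1) mono 1 (i.+1 * k) : ps algC) m.
  move=> _; rewrite (@partition_gf _ m (fun _ _ => 1)) /npart -sum1_card natr_sum.
  by apply: eq_bigr => mu _; rewrite big1.
case: n => [|[|n]].
- by rewrite gf // big_ord0 /= !big_ord_recl big_ord0 /= /Mcrank /= mulr1 addr0.
- rewrite gf // big_ord1 /= !big_ord_recl !big_ord0 /= /Mcrank /=.
  by rewrite !exp1rz !addr0 !mulr1; ring.
rewrite /= (eq_bigr (fun k : 'I_(2 * n.+2).+1 => (Mcrank (k%:Z - n.+2%:Z) n.+2)%:~R * 1)) => [|k _].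
  rewrite (sum_Mcrank (fun=> 1)) // /npart -sum1_card natr_sum.
  by apply: eq_bigr.
by rewrite exp1rz.
Qed.

Lemma root_sum (m : int) :
  \sum_(j < 11) (z ^ m) ^+ j = if (11 %| m)%Z then 11 else 0.
Proof.
have -> : z ^ m = z ^+ absz (m %% 11)%Z.
  have E : m = 11 * (m %/ 11)%Z + (absz (m %% 11)%Z)%:Z by lia.
  by rewrite [in LHS]E expfzDr // -exprz_exp -(exprnP z 11) z11 exp1rz mul1r.
have -> : (11 %| m)%Z = (11 %| absz (m %% 11)%Z)%N by apply/idP/idP; lia.
set k := absz _; rewrite (prim_order_dvd zP); case: eqP => [->|/eqP k1].
  by rewrite (eq_bigr (fun=> 1)) => [|j _]; rewrite ?expr1n // sumr_const card_ord.
apply: (mulfI (x := z ^+ k - 1)); first by rewrite subr_eq0.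
by rewrite -subrX1 mulr0 exprAC z11 expr1n subrr.
Qed.

Lemma Mmod_fourier (a : int) n :
  \sum_(j < 11) (z ^ (- a)) ^+ j * crank_series (z ^+ j) n = 11 * (Mmod a 11 n)%:~R.
Proof.
rewrite /= (eq_bigr (fun j : 'I_11 => \sum_(k < (2 * n).+1)
   (Mcrank (k%:Z - n%:Z) n)%:~R * (z ^ (k%:Z - n%:Z - a)) ^+ j)) => [|j _]; last first.
  rewrite mulr_sumr; apply: eq_bigr => k _.
  rewrite [z ^ (_ - a)]expfzDr // exprMn.
  have -> : (z ^+ j) ^ (k%:Z - n%:Z) = (z ^ (k%:Z - n%:Z)) ^+ j by rewrite !exprnP exprzAC.
  by ring.
rewrite exchange_big /= /Mmod rmorph_sum mulr_sumr [RHS]big_mkcond.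
apply: eq_bigr => k _; rewrite -mulr_sumr root_sum.
by case: ifP => _; rewrite ?mulr0 // mulrC.
Qed.

(** Summing z^(j (k - a)) over j = 1, ..., 10 gives 10 if k = a and -1 otherwise, hence this
    combination. It is unchanged when a multiple of 1 + z + ... + z^10 is added to the
    multiplier. *)
Definition v11_coef (a i : nat) : int :=
  let c := nth [::] term_c i in 11 * c`_a - \sum_(k < 11) c`_k.

Lemma DC_v11_term (a n : nat) : (a < 11)%N ->
  emb (DC a%:Z) n = 11^-1 * \sum_(i < 10) (v11_coef a i)%:~R * v11_term i n.
Proof.
move=> a11; have n11 : 11 != 0 :> algC by rewrite pnatr_eq0.
apply: (mulfI n11); rewrite mulVKf //.
rewrite /= /DC rmorphB rmorph_int rmorphM fmorphV !rmorph_nat mulrBr [11 * (_ / _)]mulrC divfK //.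
(* The summand j = 0 is p(n) and cancels the subtraction in [DC]; for the others z^j is primitive
   and [crank_series_v11] applies. *)
rewrite -(Mmod_fourier a n) big_ord_recl expr0 mul1r -npart_crank addrAC subrr add0r.
rewrite (eq_bigr (fun j : 'I_10 => \sum_(i < 10) \sum_(k < 11)
  ((nth [::] term_c i)`_k)%:~R * (z ^ (k%:Z - a%:Z)) ^+ j.+1 * v11_term i n)) => [|j _]; last first.
  rewrite crank_series_v11; last first.
    by rewrite prim_root_exp_coprime // coprime_sym prime_coprime // gtnNdvd // ltnS; have := ltn_ord j.
  rewrite cf_sum mulr_sumr; apply: eq_bigr => i _.
  rewrite mono_mulE subn0 /term_coef mulr_suml mulr_sumr; apply: eq_bigr => k _.
  rewrite -[nat_of_ord (lift ord0 j)]/(j.+1) (exprAC z j.+1 k).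
  rewrite expfzDr // exprMn -exprnP; move: (v11_term i n) => v.
  by ring.
rewrite exchange_big; apply: eq_bigr => i _; rewrite exchange_big /= /v11_coef.
rewrite (eq_bigr (fun k : 'I_11 => ((nth [::] term_c i)`_k)%:~R *
   ((if k == a :> nat then 11 else 0) - 1) * v11_term i n)) => [|k _]; last first.
  rewrite -mulr_suml -mulr_sumr; congr (_ * _ * _).
  apply: (addrI ((z ^ (k%:Z - a%:Z)) ^+ 0)).
  have := root_sum (k%:Z - a%:Z); rewrite big_ord_recl => ->.
  have -> : (11 %| k%:Z - a%:Z)%Z = (k == a :> nat).
    by have k11 := ltn_ord k; apply/idP/idP => [d|/eqP ->]; [apply/eqP; lia|rewrite subrr].
  by rewrite expr0 [RHS]addrC subrK.
rewrite -mulr_suml; congr (_ * _).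
rewrite rmorphB rmorphM /= rmorph_sum /= -(big_mkord xpredT (fun k => ((nth [::] term_c i)`_k)%:~R : algC)).
rewrite (eq_bigr (fun k : 'I_11 => (if k == a :> nat then 11 * ((nth [::] term_c i)`_k)%:~R else 0) - ((nth [::] term_c i)`_k)%:~R)) => [|k _].
  rewrite sumrB big_mkord; congr (_ - _).
  by rewrite -big_mkcond (big_pred1 (Ordinal a11)).
by case: ifP => _; ring.
Qed.

End FourierInversion.

Lemma DC_v11 (a : nat) (l : seq int) : (a < 11)%N ->
  (forall i, (i < 10)%N -> l`_i = v11_coef a i) ->
  DC a%:Z = v11 l`_0 l`_1 l`_2 l`_3 l`_4 l`_5 l`_6 l`_7 l`_8 l`_9.
Proof.
move=> a11 lE; have [z zP] := C_prim_root_exists (isT : (0 < 11)%N).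
apply: boolp.funext => n; apply: (fmorph_inj (ratr : {rmorphism rat -> algC})).
rewrite -[LHS]/(emb _ n) -[RHS]/(emb _ n) (DC_v11_term zP) // emb_v11.
rewrite mono_mulE subn0 cf_sum; congr (_ * _); apply: eq_bigr => i _.
by rewrite mono_mulE subn0 lE.
Qed.

Theorem theorem1p1 :
  (DC 0 = v11 10 (-12) (-2) 8 6 4 (-4) (-6) (-8) 2) /\
  (DC 1 = v11 (-1) 10 (-2) (-3) (-5) 4 7 5 3 2) /\
  (DC 2 = v11 (-1) (-1) 9 (-3) 6 (-7) (-4) (-6) 3 2) /\
  (DC 3 = v11 (-1) (-1) (-2) 8 (-5) 4 (-4) 5 3 (-9)) /\
  (DC 4 = v11 (-1) (-1) (-2) (-3) 6 (-7) 7 5 (-8) 2) /\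
  (DC 5 = v11 (-1) (-1) (-2) (-3) (-5) 4 (-4) (-6) 3 2).
Proof.
(* Written with [foldr], the sum of the multiplier's coefficients computes, and the ten entries of
   each list are checked by evaluation. *)
have E a l (a11 : (a < 11)%N) :
    all (fun i => l`_i == 11 * (nth [::] term_c i)`_a - foldr +%R 0 (nth [::] term_c i)) (iota 0 10) ->
    DC a%:Z = v11 l`_0 l`_1 l`_2 l`_3 l`_4 l`_5 l`_6 l`_7 l`_8 l`_9.
  move=> /allP H; apply: DC_v11 => // i i10; rewrite (eqP (H i _)) ?mem_iota //.
  rewrite /v11_coef; congr (_ - _).
  by case: i i10 {H} => [|[|[|[|[|[|[|[|[|[|]]]]]]]]]] // _; rewrite !big_ord_recr big_ord0 /term_c /=; ring.
do ?split.
- exact: (E 0%N [:: 10; -12; -2; 8; 6; 4; -4; -6; -8; 2] isT isT).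
- exact: (E 1%N [:: -1; 10; -2; -3; -5; 4; 7; 5; 3; 2] isT isT).
- exact: (E 2%N [:: -1; -1; 9; -3; 6; -7; -4; -6; 3; 2] isT isT).
- exact: (E 3%N [:: -1; -1; -2; 8; -5; 4; -4; 5; 3; -9] isT isT).
- exact: (E 4%N [:: -1; -1; -2; -3; 6; -7; 7; 5; -8; 2] isT isT).
- exact: (E 5%N [:: -1; -1; -2; -3; -5; 4; -4; -6; 3; 2] isT isT).
Qed.
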